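(* Let $v\in[0,1]$, and consider the variational problem (V) minimize $E[g_k(\varphi)f(\varphi)]$ among all increasing functions $f$ on $(0,\infty)$ with $0\le f\le1$ and $E[\varphi f(\varphi)]=v$. (a) If $f^*$ solves (V), then $X^*:=f^*(\varphi)$ solves the Neyman–Pearson problem for $\rho_k$ with capital constraint $v$. (b) There exists a function $f^*\in\mathcal J$ that solves (V). (c) If $f^*$ is such that $f^*(\varphi)$ solves the Neyman–Pearson problem for $\rho_k$ with capital constraint $v$, then $f^*$ solves (V). (d) If the solution $f^*\in\mathcal J$ of part (b) is unique within $\mathcal J$ up to $(P\circ\varphi^{-1})$-nullsets, then $X^*=f^*(\varphi)$ is the $P$-a.s. unique $\sigma(\varphi)$-measurable solution to the Neyman–Pearson problem for $\rho_k$ with capital constraint $v$.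
   Context: $(\Omega,\mathcal F,P)$ is an atomless probability space, and the price density $\varphi$ is a random variable with $\varphi>0$ $P$-a.s. and $E[\varphi]=1$; $F_\varphi$ is its distribution function under $P$. ''Increasing'' means nondecreasing. $k:[0,1)\to[0,\infty)$ is an increasing right-continuous function with $\int_0^1k(t)\,dt=1$, and $\rho_k(-X):=\int_0^1k(t)q_X(t)\,dt$ for $X\in L^\infty(\Omega,\mathcal F,P)$, where $q_X$ is a quantile function of $X$ under $P$. The Neyman–Pearson problem for $\rho_k$ with capital constraint $v$ is (with upper bound normalized to $K=1$): minimize $\rho_k(-X)$ over all random variables $X$ with $0\le X\le1$ and $E[\varphi X]\ge v$. The function $g_k$ is defined by $g_k(x)=k(F_\varphi(x))$ if $F_\varphi$ is continuous at $x$, and $$g_k(x)=\frac1{F_\varphi(x)-F_\varphi(x-)}\int_{F_\varphi(x-)}^{F_\varphi(x)}k(t)\,dt$$ otherwise. (Points $x$ at which $F_\varphi$ is continuous and $F_\varphi(x)=1$ form a $P\circ\varphi^{-1}$-nullset, so the value of $g_k$ there is immaterial.) $\mathcal J$ is the class of all increasing step functions $f:(0,\infty)\to[0,1]$ that take at most one value in $(0,1)$; more precisely, each $f\in\mathcal J$ is of the form $f=\beta\mathbb I_{J_0}+\mathbb I_{J_1}$ for some $\beta\in(0,1)$ and two disjoint intervals $J_0,J_1\subset(0,\infty)$ such that $J_0$ is either empty or satisfies $P[\varphi\in J_0]>0$. Intervals may be empty or consist of a single point. (Since $f$ is increasing, $J_1$ is empty or unbounded to the right, and if both are nonempty the right endpoint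 of $J_0$ is the left endpoint of $J_1$.)
   Formalization: In (c), f* may be altered on a null set of the law of φ and lose monotonicity, so what is proved is that f*(φ) = h(φ) P-a.s. for some solution h of (V), and that f* itself solves (V) if it is increasing with 0 ≤ f* ≤ 1 on (0,∞). *)

(* Defs.v *)
From HB Require Import structures.
From mathcomp Require Import all_boot all_order all_algebra.
From mathcomp Require Import all_classical all_reals all_analysis.

Set Implicit Arguments.
Unset Strict Implicit.
Unset Printing Implicit Defensive.

Import Order.TTheory GRing.Theory Num.Theory.
Import numFieldNormedType.Exports.

Local Open Scope classical_set_scope.
Local Open Scope ring_scope.

Definition atomless d (T : measurableType d) (R : realType)
    (P : probability T R) : Prop :=
  forall A : set T, measurable A -> (0 < P A)%E ->
    exists B : set T,
      [/\ measurable B, B `<=` A, (0 < P B)%E & (P B < P A)%E].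

(* Only the restriction of [k] to [0, 1) is constrained, and only that
   restriction matters below, up to null sets. *)
Definition density_weight (R : realType) (k : R -> R) : Prop :=
  [/\ {in `[0, 1[, forall t, 0 <= k t},
      {in `[0, 1[ &, {homo k : s t / s <= t}},
      {in `[0, 1[, forall t, k x @[x --> t^'+] --> k t} &
      (\int[lebesgue_measure]_(t in `[0%R, 1%R[) (k t)%:E = 1)%E].

Section defs.
Context d (T : measurableType d) (R : realType) (P : probability T R).

(* The lower quantile function.  All quantile functions of [X] agree on (0, 1)
   outside a countable set, so [rho_neg] does not depend on this choice. *)
Definition quantile (X : {RV P >-> R}) (t : R) : R :=
  inf [set x : R | (t%:E <= cdf X x)%E].

(* rho_k (- X) *)
Definition rho_neg (k : R -> R) (X : {RV P >-> R}) : \bar R :=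
  (\int[lebesgue_measure]_(t in `]0%R, 1%R[) (k t * quantile X t)%:E)%E.

Definition NP_admissible (phi : {RV P >-> R}) (v : R) (X : {RV P >-> R}) :
    Prop :=
  {ae P, forall w, 0 <= X w <= 1} /\
  (v%:E <= 'E_P[fun w => (phi w * X w)%R])%E.

Definition NP_minimizer (k : R -> R) (phi : {RV P >-> R}) (v : R)
    (X : {RV P >-> R}) : Prop :=
  NP_admissible phi v X /\
  forall Y : {RV P >-> R}, NP_admissible phi v Y ->
    (rho_neg k X <= rho_neg k Y)%E.

(* The function [X] is a random variable, and it solves the problem. *)
Definition NP_solution (k : R -> R) (phi : {RV P >-> R}) (v : R)
    (X : T -> R) : Prop :=
  exists2 X' : {RV P >-> R}, X' = X :> (T -> R) & NP_minimizer k phi v X'.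

Definition dfun (phi : {RV P >-> R}) (x : R) : R := fine (cdf phi x).

Definition g_of (k : R -> R) (phi : {RV P >-> R}) (x : R) : R :=
  let F := dfun phi in
  let Fl := lim (F y @[y --> x^'-]) in
  if `[< {for x, continuous F} >] then k (F x)
  else (F x - Fl)^-1 * \int[lebesgue_measure]_(t in `[Fl, F x[) k t.

(* A function on (0, oo) is represented by a function on [R] whose values
   outside (0, oo) are irrelevant.  Since [phi] is positive only almost surely,
   f(phi) is set to [0] on the null event where it is not positive. *)
Definition comp_pos (f : R -> R) (phi : {RV P >-> R}) : T -> R :=
  (f \_ `]0, +oo[) \o phi.

Definition increasing01 (f : R -> R) : Prop :=
  {in `]0, +oo[ &, {homo f : x y / x <= y}} /\
  {in `]0, +oo[, forall x, 0 <= f x <= 1}.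

Definition V_admissible (phi : {RV P >-> R}) (v : R) (f : R -> R) : Prop :=
  increasing01 f /\
  ('E_P[fun w => (phi w * comp_pos f phi w)%R] = v%:E)%E.

Definition V_objective (k : R -> R) (phi : {RV P >-> R}) (f : R -> R) :
    \bar R :=
  'E_P[fun w => (g_of k phi (phi w) * comp_pos f phi w)%R]%E.

Definition V_solution (k : R -> R) (phi : {RV P >-> R}) (v : R)
    (f : R -> R) : Prop :=
  V_admissible phi v f /\
  forall h : R -> R, V_admissible phi v h ->
    (V_objective k phi f <= V_objective k phi h)%E.

Definition classJ (phi : {RV P >-> R}) (f : R -> R) : Prop :=
  increasing01 f /\
  exists (beta : R) (J0 J1 : set R),
    [/\ 0 < beta < 1,
        [/\ is_interval J0, is_interval J1,
            J0 `<=` `]0, +oo[ & J1 `<=` `]0, +oo[],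
        J0 `&` J1 = set0,
        J0 = set0 \/ (0 < distribution P phi J0)%E &
        {in `]0, +oo[, forall x, f x = beta * \1_J0 x + \1_J1 x}].

Definition sigma_measurable (phi : {RV P >-> R}) (X : T -> R) : Prop :=
  measurable_fun [set: g_sigma_algebra_preimageType phi]
    (X : g_sigma_algebra_preimageType phi -> R).

End defs.

(* Main.v *)
Require Import Defs.
From HB Require Import structures.
From mathcomp Require Import all_boot all_order all_algebra.
From mathcomp Require Import all_classical all_reals all_analysis.
From mathcomp Require Import measurable_realfun ring lra.

(** Write [q] for the quantile function of the price density [phi], and for an
    event of probability [1 - u] compare the two numbers

      K u = tail k u = int_u^1 k,     L u = tail q u = int_u^1 q.

    The first is the risk [rho_k] of the indicator of the event; the second is, by
    the Neyman-Pearson lemma, its largest possible price E[phi; A], attained by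
    the upper sets [phi > a] and [phi >= a].  By the layer-cake formula, a claim
    [Y] with values in [0, 1] is a mixture over [s] in (0, 1) of the indicators of
    its level events [Y > s], and both risk and price are additive along this
    mixture:

      rho_k(-Y) = int_0^1 K (P[Y <= s]) ds,
      E[phi Y] = int_0^1 E[phi; Y > s] ds <= int_0^1 L (P[Y <= s]) ds

    ([rho_neg_tail], [expectation_price], [np_le]).  So the problem is to find the
    lower convex hull of the planar curve [u |-> (L u, K u)] at abscissa [v].  For
    [0 < v < 1] the curve has a supporting line of positive slope [lam] which
    touches it on both sides of [v] ([supporting_line]).  Integrating this line
    over the levels bounds the risk of every admissible claim ([lagrangian_le]),
    and a mixture of two contact points attains the bound.  The contact points can
    be taken to be levels of upper sets ([contact_upper]): between two such levels
    [L] is affine and [K] is concave.  The mixture of two nested upper sets is a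
    profile of the class J, whence the existence of a solution which is optimal
    among all claims.

    The increasing problem is the same problem restricted to claims f(phi) with [f]
    increasing: the function [g_k] is built so that E[g_k(phi) f(phi)] equals
    rho_k(-f(phi)) ([V_objective_rho]).  Indeed [g_k(q)] is the conditional
    expectation of [k] given [q] ([integral_g_of_quantile]), and the level events
    of f(phi) are upper sets.

    Conversely, for an optimal claim there is equality at almost every level
    ([lagrangian_eq]): the level lies on the supporting line, and the event
    [Y > s] is a maximizer in the Neyman-Pearson lemma, hence an upper set if [Y]
    is a function of [phi].  So optimal claims that are functions of [phi] are
    increasing profiles ([increasing_versionP]).  If moreover the solution in the
    class J is unique, then any two contact levels on both sides of [v] must
    produce it, which determines almost all level sets of every optimal profile
    ([unique_solution]).

    At [v = 0] and [v = 1] supporting lines may degenerate, and the constant claim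
    [v] is the only optimal one ([solvable0], [solvable1]). *)

Set Implicit Arguments.
Unset Strict Implicit.
Unset Printing Implicit Defensive.

Import Order.TTheory GRing.Theory Num.Theory.
Import numFieldNormedType.Exports.

Local Open Scope classical_set_scope.
Local Open Scope ring_scope.

(** * Nondecreasing weights on the unit interval *)

Section nondecreasing_weight.
Context {R : realType}.
Local Notation mu := (@lebesgue_measure R).

(** The shape shared by [k] and by the quantile function of the price density:
    the two sides of the problem, risk and price, are treated by the same lemmas. *)
Definition weight (w : R -> R) : Prop :=
  [/\ {in `]0, 1[, forall t, 0 <= w t},
      {in `]0, 1[ &, {homo w : s t / s <= t}} &
      (\int[mu]_(t in `]0%R, 1%R[) (w t)%:E = 1)%E].

(** If [A] is an event of probability [1 - u], then [tail k u] is the value of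
    [rho_k] at the loss [1_A], and [tail q u], for [q] the quantile function of
    the price density, is the largest price that such an event can have. *)
Definition tail (w : R -> R) (u : R) : R := \int[mu]_(t in `]u, 1[) w t.

(** The preimage of a ray under a monotone function is an interval. *)
Lemma measurable_fun_homo_in (D : set R) (f : R -> R) : is_interval D ->
  {in D &, {homo f : s t / s <= t}} -> measurable_fun D f.
Proof.
move=> iD fD; have mD : measurable D by exact: is_interval_measurable.
apply: (measurability (@RGenCInfty.G R)) => [|/= _ [_] [r] -> <-].
  exact: RGenCInfty.measurableE.
apply: is_interval_measurable => s t/=.
rewrite !in_itv/= !andbT => -[Ds fs] [Dt ft] u /andP[su ut].
have Du : D u by apply: (iD s t) => //; rewrite su ut.
split=> //; rewrite in_itv/= andbT (le_trans fs)// fD// inE//.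
Qed.

Lemma weight_measurable w : weight w -> measurable_fun (`]0, 1[ : set R) w.
Proof.
move=> [_ wnd _]; apply: measurable_fun_homo_in; first exact: interval_is_interval.
by move=> s t; rewrite !inE/=; exact: wnd.
Qed.

Lemma weight_integrable w : weight w -> mu.-integrable (`]0, 1[ : set R) (EFin \o w).
Proof.
move=> ww; have [w0 _ w1] := ww; apply/integrableP; split.
  by apply/measurable_EFinP; exact: weight_measurable.
rewrite (@eq_integral _ _ _ mu _ (EFin \o w)); last first.
  by move=> t; rewrite inE/= => t01; rewrite ger0_norm// w0.
by rewrite w1 ltry.
Qed.

Section fixed_weight.
Variables (w : R -> R) (ww : weight w).

Let w0 : {in `]0, 1[, forall t, 0 <= w t}. Proof. by case: ww. Qed.
Let wnd : {in `]0, 1[ &, {homo w : s t / s <= t}}. Proof. by case: ww. Qed.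

Let wint (D : set R) : measurable D -> D `<=` `]0, 1[ ->
  mu.-integrable D (EFin \o w).
Proof. by move=> mD D01; apply: integrableS (weight_integrable ww). Qed.

Let sub01 (a b : R) : 0 <= a -> b <= 1 -> `]a, b[ `<=` (`]0, 1[ : set R).
Proof.
move=> a0 b1 t/=; rewrite !in_itv/= => /andP[t1 t2].
by rewrite (le_lt_trans a0 t1) (lt_le_trans t2 b1).
Qed.

Lemma tailE u : 0 <= u ->
  (\int[mu]_(t in `]u, 1%R[) (w t)%:E)%E = (tail w u)%:E.
Proof.
move=> u0; rewrite /tail /Rintegral fineK//; apply: integrable_fin_num => //.
by apply: wint => //; exact: sub01.
Qed.

Lemma tail_ge0 u : 0 <= u -> 0 <= tail w u.
Proof.
move=> u0; apply: Rintegral_ge0 => t /=; rewrite in_itv/= => /andP[ut t1].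
by apply: w0; rewrite in_itv/= t1 (le_lt_trans u0 ut).
Qed.

Lemma tail0 : tail w 0 = 1.
Proof. by case: ww => _ _; rewrite tailE// => -[]. Qed.

Lemma tail1 : tail w 1 = 0.
Proof. by rewrite /tail set_itvoo0 Rintegral_set0. Qed.

Lemma tailB (u s : R) : 0 <= u -> u <= s -> s <= 1 ->
  tail w u - tail w s = \int[mu]_(t in `]u, s[) w t.
Proof.
move=> u0; rewrite le_eqVlt => /predU1P[<- _|us].
  by rewrite subrr set_itvoo0 Rintegral_set0.
rewrite le_eqVlt => /predU1P[->|s1]; first by rewrite tail1 subr0.
rewrite /tail; apply/eqP; rewrite subr_eq; apply/eqP.
rewrite (@Rintegral_itv_bndo_bndc _ _ s) ?wint//; last first.
  by apply: sub01 => //; exact: ltW.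
rewrite -Rintegral_setU//=.
- by rewrite -(@itv_bndbnd_setU _ _ (BRight u) (BRight s) (BLeft 1)) ?bnd_simp ?ltW.
- rewrite -(@itv_bndbnd_setU _ _ (BRight u) (BRight s) (BLeft 1)) ?bnd_simp ?ltW//.
  by apply: wint => //; exact: sub01.
- apply/disj_setPLR => t/=; rewrite !in_itv/= => /andP[_ ts].
  by apply/negP; rewrite ltNge ts.
Qed.

Lemma tail_nonincreasing (u s : R) : 0 <= u -> u <= s -> s <= 1 -> tail w s <= tail w u.
Proof.
move=> u0 us s1; rewrite -subr_ge0 tailB//; apply: Rintegral_ge0 => t /=.
by move=> tus; apply: w0; exact: (sub01 u0 s1).
Qed.

Lemma tail_le1 u : 0 <= u -> u <= 1 -> tail w u <= 1.
Proof. by move=> u0 u1; rewrite -tail0; exact: tail_nonincreasing. Qed.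

Let tailBcst (u s : R) : 0 <= u -> u <= s -> s <= 1 ->
  forall x, \int[mu]_(t in `]u, s[) (cst x t) = x * (s - u).
Proof.
move=> u0 us s1 x; rewrite Rintegral_cst//= lebesgue_measure_itv/= lte_fin.
by case: ltgtP us => //= ->; rewrite subrr.
Qed.

Let cst_int (a b x : R) : mu.-integrable `]a, b[ (EFin \o cst x).
Proof.
apply: measurable_bounded_integrable => //=.
  rewrite lebesgue_measure_itv/=; case: ifP => // _; exact: ltry.
by exists `|x|; split; [rewrite num_real|move=> y xy t _; exact: ltW].
Qed.

(** [tail w] is concave with slope [- w t] at [t]: since [w] is nondecreasing, it
    is at most [w t] to the left of [t] and at least [w t] to the right. *)
Lemma tail_supergradient (t u : R) : t \in `]0, 1[ -> u \in `[0, 1] ->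
  tail w u <= tail w t + w t * (t - u).
Proof.
rewrite !in_itv/= => /andP[t0 t1] /andP[u0 u1].
have [ut|tu] := leP u t.
  rewrite -lerBlDl tailB// ?(ltW t1)// -(tailBcst u0 ut (ltW t1)).
  apply: le_Rintegral => //.
    by apply: wint => //; apply: sub01 => //; exact: ltW.
  move=> s/=; rewrite in_itv/= => /andP[us st]; apply: wnd; rewrite ?in_itv/= ?t0 ?t1//.
    by rewrite (le_lt_trans u0 us) (lt_trans st t1).
  exact: ltW.
rewrite -[t - u]opprB mulrN lerBrDr -lerBrDl.
rewrite tailB// ?(ltW t0) ?(ltW tu)// -(tailBcst (ltW t0) (ltW tu) u1).
apply: le_Rintegral => //.
  by apply: wint => //; apply: sub01 => //; exact: ltW.
move=> s/=; rewrite in_itv/= => /andP[us st]; apply: wnd; rewrite ?in_itv/= ?t0 ?t1//.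
  by rewrite (lt_trans t0 us) (lt_le_trans st u1).
exact: ltW.
Qed.

Lemma tail_affine (a b x u : R) : 0 <= a -> b <= 1 ->
  {in `]a, b[, forall t, w t = x} -> u \in `[a, b] ->
  tail w a = tail w u + x * (u - a) /\ tail w b = tail w u + x * (u - b).
Proof.
move=> a0 b1 wx; rewrite in_itv/= => /andP[au ub].
have wxE c d : a <= c -> c <= d -> d <= b -> tail w c - tail w d = x * (d - c).
  move=> ac cd db; rewrite tailB ?(le_trans a0)// ?(le_trans db)//.
  rewrite -(tailBcst _ cd) ?(le_trans a0)// ?(le_trans db)//.
  apply: eq_Rintegral => t; rewrite inE/= in_itv/= => /andP[ct td]; apply: wx.
  by rewrite in_itv/= (le_lt_trans ac ct) (lt_le_trans td db).
split; apply/eqP.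
  by rewrite addrC -subr_eq wxE.
by have /eqP := wxE _ _ au ub (lexx b); rewrite subr_eq => /eqP ->; apply/eqP; ring.
Qed.

(** A nondecreasing weight which is positive somewhere is bounded away from [0]
    near [1]. *)
Lemma tail_gt0 u : u \in `[0, 1[ -> 0 < tail w u.
Proof.
rewrite in_itv/= => /andP[u0 u1].
have [[t t01 wt]|/forall2NP wle0] := pselect (exists2 t, t \in `]0, 1[ & 0 < w t).
  have /andP[t0 t1] : 0 < t < 1 by rewrite in_itv/= in t01.
  pose s := Num.max t u.
  have s1 : s < 1 by rewrite /s gt_max t1 u1.
  have s0 : 0 < s by rewrite /s lt_max t0.
  have s01 : s \in `]0, 1[ by rewrite in_itv/= s0.
  apply: (@lt_le_trans _ _ (tail w s)); last first.
    by apply: tail_nonincreasing => //; [rewrite /s le_max lexx orbT|exact: ltW].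
  have := tail_supergradient (u := 1) s01.
  rewrite in_itv/= ler01 lexx => /(_ isT); rewrite tail1 => ts.
  have ws : 0 < w s.
    by apply: (lt_le_trans wt); apply: wnd => //; rewrite /s le_max lexx.
  have : 0 < w s * (1 - s) by rewrite mulr_gt0// subr_gt0.
  by move: ts; rewrite -[s - 1]opprB mulrN; lra.
exfalso; have := tail0; rewrite /tail (@eq_Rintegral _ _ _ _ _ (cst 0)); last first.
  move=> t; rewrite inE/= => t01; have [//|/negP] := wle0 t.
  by rewrite -leNgt => wt; apply/eqP; rewrite eq_le wt w0.
by rewrite (@tailBcst 0 1)// mul0r => /esym/eqP; rewrite oner_eq0.
Qed.

Lemma tail_continuous : {within `[0, 1], continuous (tail w)}.
Proof.
have int01 : mu.-integrable (`[0, 1] : set R) (EFin \o w).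
  have := wint (D := `]0,1[) (measurable_itv _) (fun t => id).
  move=> /integrableP[mw fw]; apply/integrableP; split.
    apply/emeasurable_fun_itv_obnd_cbndP.
    exact/emeasurable_fun_itv_bndo_bndcP.
  rewrite (@integral_itv_bndoo _ 0 1)//; exact: measurableT_comp.
have := parameterized_integral_continuous ler01 int01.
move=> ci.
apply: (@subspace_eq_continuous _ _ _ (fun u => 1 - parameterized_integral mu 0 u w)).
  move=> u; rewrite inE/= in_itv/= => /andP[u0 u1].
  rewrite /parameterized_integral -tail0.
  rewrite -(@Rintegral_itv_obnd_cbnd _ 0 (BRight u)); last first.
    apply: integrableS int01 => //; apply: subset_itv => //.
      by rewrite bnd_simp.
  rewrite -Rintegral_itv_bndo_bndc; last first.
    by apply: wint => //; exact: sub01.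
  rewrite /= -tailB// subKr//.
move=> x; apply: cvgB; [exact: cvg_cst|exact: ci].
Qed.

End fixed_weight.
End nondecreasing_weight.

(** * The layer-cake formula *)

Section layer_cake.
Context {d} {T : measurableType d} {R : realType}.
Variable m : {sigma_finite_measure set T -> \bar R}.
Local Notation mu := (@lebesgue_measure R).

Section global.
Variables W X Y : T -> R.
Hypotheses (mW : measurable_fun setT W) (mX : measurable_fun setT X)
  (mY : measurable_fun setT Y).
Hypothesis W0 : forall x, 0 <= W x.

(* the region of the product space between the graphs of [X] and [Y] *)
Let slab : set (T * R) := [set p | X p.1 < p.2 < Y p.1].
Let F (p : T * R) : \bar R := (W p.1 * \1_slab p)%:E.

Let mslab : measurable slab.
Proof.
rewrite (_ : slab = (fun p => X p.1 < p.2) @^-1` [set true] `&`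
   (fun p => p.2 < Y p.1) @^-1` [set true]); last first.
  by apply/seteqP; split => p /=; rewrite /slab/= => /andP.
apply: measurableI.
- have : measurable_fun setT (fun p : T * R => X p.1 < p.2).
    apply: measurable_fun_ltr => //.
    exact: measurableT_comp.
  by move=> /(_ measurableT [set true]); rewrite setTI; exact.
- have : measurable_fun setT (fun p : T * R => p.2 < Y p.1).
    apply: measurable_fun_ltr => //.
    exact: measurableT_comp.
  by move=> /(_ measurableT [set true]); rewrite setTI; exact.
Qed.

Let mF : measurable_fun setT F.
Proof.
apply/measurable_EFinP; apply: measurable_funM.
  exact: measurableT_comp.
exact: measurable_indic.
Qed.

Let F0 p : (0 <= F p)%E. Proof. by rewrite lee_fin mulr_ge0. Qed.

Let slice s : (\int[m]_(x in [set x | (X x < s < Y x)%R]) (W x)%:E =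
  \int[m]_x F (x, s))%E.
Proof.
rewrite integral_mkcond; apply: eq_integral => x _.
rewrite /F patchE indicE /slab.
have -> : ((x, s) \in [set p | X p.1 < p.2 < Y p.1]) = (X x < s < Y x).
  by apply/idP/idP; rewrite inE.
have -> : (x \in [set x | X x < s < Y x]) = (X x < s < Y x).
  by apply/idP/idP; rewrite inE.
by case: ifP; rewrite /= ?mulr1 ?mulr0.
Qed.

Lemma layer_cake_measurableT : measurable_fun setT
  (fun s => \int[m]_(x in [set x | (X x < s < Y x)%R]) (W x)%:E)%E.
Proof.
under eq_fun do rewrite slice.
exact: (@measurable_fun_fubini_tonelli_G _ _ _ _ _ m F mF F0).
Qed.

Lemma layer_cakeT : (forall x, 0 <= X x) -> (forall x, Y x <= 1) ->
  (\int[m]_x (W x * Num.max (Y x - X x) 0)%:E =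
   \int[mu]_(s in `]0%R, 1%R[) \int[m]_(x in [set x | (X x < s < Y x)%R])
     (W x)%:E)%E.
Proof.
move=> X0 Y1; rewrite [RHS]integral_mkcond.
transitivity (\int[mu]_s \int[m]_x F (x, s))%E; last first.
  apply: eq_integral => s _; rewrite patchE; case: ifPn => [_|]; first by rewrite slice.
  rewrite notin_setE/= in_itv/= => s01; apply: integral0_eq => x _.
  rewrite /F indicE memNset ?mulr0// /slab/= => /andP[Xs sY]; apply: s01.
  by rewrite (le_lt_trans (X0 x) Xs) (lt_le_trans sY (Y1 x)).
rewrite -(@fubini_tonelli _ _ _ _ _ m mu F mF F0); apply: eq_integral => x _.
transitivity (\int[mu]_s ((W x)%:E * (\1_(`]X x, Y x[) s)%:E))%E.
  rewrite ge0_integralZl_EFin//; last first.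
    by apply/measurable_EFinP; exact: measurable_indic.
  rewrite integral_indic//= setIT lebesgue_measure_itv/= lte_fin.
  case: ltP => XY; first by rewrite max_l ?subr_ge0 ?ltW// -EFinB -EFinM.
  by rewrite max_r ?subr_le0// mulr0 mule0.
by apply: eq_integral => s _; rewrite /F -EFinM /=; congr (_ * _)%:E.
Qed.

End global.

Section on_subset.
Variables (D : set T) (W X Y : T -> R).
Hypotheses (mD : measurable D) (mW : measurable_fun D W)
  (mX : measurable_fun D X) (mY : measurable_fun D Y).
Hypothesis W0 : forall x, D x -> 0 <= W x.

Let restr s : (\int[m]_(x in D `&` [set x | (X x < s < Y x)%R]) (W x)%:E =
  \int[m]_(x in [set x | ((X \_ D) x < s < (Y \_ D) x)%R]) ((W \_ D) x)%:E)%E.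
Proof.
rewrite integral_mkcond [RHS]integral_mkcond; apply: eq_integral => x _.
rewrite !patchE in_setI; case: ifPn => [/andP[xD]|].
  rewrite inE/= => XY; rewrite xD.
  by rewrite mem_set//= !patchE xD.
rewrite negb_and => /orP[xD|].
  by rewrite (negbTE xD) if_same.
have [xD|//] := boolP (x \in D); last by rewrite if_same.
rewrite notin_setE/= => nXY.
by rewrite memNset//= !patchE xD.
Qed.

Lemma layer_cake_measurable : measurable_fun setT
  (fun s => \int[m]_(x in D `&` [set x | (X x < s < Y x)%R]) (W x)%:E)%E.
Proof.
under eq_fun do rewrite restr.
apply: layer_cake_measurableT; [by apply/(measurable_restrictT _ mD)..|].
by move=> x; rewrite patchE; case: ifPn => // /set_mem /W0.
Qed.

(** Tonelli for [W] on the region between the graphs of [X] and [Y].  For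
    [X = 0] this is the usual formula; the two-sided form also allows to compare
    two variables through the events [X < s < Y]. *)
Lemma layer_cake : (forall x, D x -> 0 <= X x) -> (forall x, D x -> Y x <= 1) ->
  (\int[m]_(x in D) (W x * Num.max (Y x - X x) 0)%:E =
   \int[mu]_(s in `]0%R, 1%R[)
     \int[m]_(x in D `&` [set x | (X x < s < Y x)%R]) (W x)%:E)%E.
Proof.
move=> X0 Y1; under [RHS]eq_integral do rewrite restr.
rewrite -layer_cakeT; [|by apply/(measurable_restrictT _ mD)..| | |].
- rewrite integral_mkcond; apply: eq_integral => x _; rewrite !patchE.
  by case: ifPn; rewrite ?mul0r.
- by move=> x; rewrite patchE; case: ifPn => // /set_mem /W0.
- by move=> x; rewrite patchE; case: ifPn => // /set_mem /X0.
- by move=> x; rewrite patchE; case: ifPn => // /set_mem /Y1.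
Qed.

End on_subset.
End layer_cake.

(** * The quantile transform *)

Lemma ge0_integral_mrestr d (T : measurableType d) (R : realType)
    (m : {measure set T -> \bar R}) (D : set T) (mD : measurable D)
    (f : T -> \bar R) : measurable_fun setT f -> (forall x, 0 <= f x)%E ->
  (\int[mrestr m mD]_x f x = \int[m]_(x in D) f x)%E.
Proof.
move=> mf f0; rewrite -(setUv D) ge0_integral_setU//; last 3 first.
- exact: measurableC.
- by rewrite setUv.
- by apply/disj_setPS; rewrite setICr.
rewrite (@eq_measure_integral _ _ _ D m); last first.
  by move=> A mA AD /=; rewrite /mrestr setIidl.
rewrite (@eq_measure_integral _ _ _ (~` D) mzero); last first.
  move=> A mA AD /=; rewrite /mrestr /mzero.
  rewrite (_ : A `&` D = set0) ?measure0//.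
  by apply/seteqP; split => // x [/AD].
by rewrite integral_measure_zero adde0.
Qed.

Section quantile_transform.
Context {d} {T : measurableType d} {R : realType} {P : probability T R}.
Variable X : {RV P >-> R}.
Local Notation mu := (@lebesgue_measure R).
Local Notation F := (dfun X).
Local Notation q := (quantile X).

Lemma dfunE x : cdf X x = (F x)%:E.
Proof. by rewrite /dfun fineK// fin_num_measure. Qed.

Lemma dfun_nondecreasing : {homo F : x y / x <= y}.
Proof. by move=> x y xy; rewrite -lee_fin -!dfunE; exact: cdf_nondecreasing. Qed.

Lemma dfun_ge0 x : 0 <= F x.
Proof. by rewrite -lee_fin -dfunE cdf_ge0. Qed.

Lemma dfun_le1 x : F x <= 1.
Proof. by rewrite -lee_fin -dfunE cdf_le1. Qed.

Lemma dfun_right_continuous : right_continuous F.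
Proof.
by move=> x; apply: fine_cvg; rewrite -dfunE; exact: cdf_right_continuous.
Qed.

(** Right-continuity of the distribution function makes the infimum that defines
    the quantile a minimum; hence the Galois connection. *)
Lemma quantileP t x : t \in `]0, 1[ -> (q t <= x) = (t <= F x).
Proof.
rewrite in_itv/= => /andP[t0 t1].
pose A := [set x : R | t <= F x].
have qE : q t = inf A.
  by rewrite /quantile; congr inf; apply/seteqP; split=> y /=; rewrite dfunE lee_fin.
have A0 : A !=set0.
  have /cvgr_gt/(_ t t1) : F y @[y --> +oo] --> (1:R) by exact/fine_cvg/cvg_cdfy1.
  by move=> /filter_ex[y /ltW ty]; exists y.
have lbA : has_lbound A.
  have /cvgr_lt/(_ t t0) : F y @[y --> -oo] --> (0:R) by exact/fine_cvg/cvg_cdfNy0.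
  move=> /filter_ex[y Fyt]; exists y => z; rewrite /A/= => tFz.
  rewrite leNgt; apply/negP => /ltW /dfun_nondecreasing zy.
  by have := lt_le_trans Fyt (le_trans tFz zy); rewrite ltxx.
apply/idP/idP => [qx|tF]; last by rewrite qE; exact: ge_inf.
rewrite leNgt; apply/negP => Fxt.
have /cvgr_lt/(_ t Fxt) := @dfun_right_continuous x.
move=> xt; have [y [/= xy Fyt]] : exists y, x < y /\ F y < t.
  near x^'+ => y; exists y; split; near: y; [exact: nbhs_right_gt|exact: xt].
have : inf A < y by rewrite -qE (le_lt_trans qx).
move=> /inf_lt[//|z Az zy].
have : t <= F y by apply: (le_trans Az); apply: dfun_nondecreasing; exact: ltW.
by rewrite leNgt Fyt.
Unshelve. all: by end_near. Qed.

Lemma quantile_nondecreasing : {in `]0, 1[ &, {homo q : s t / s <= t}}.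
Proof.
by move=> s t s01 t01 st; rewrite quantileP// (le_trans st)// -quantileP.
Qed.

Lemma quantile_measurable : measurable_fun (`]0, 1[ : set R) q.
Proof.
apply: measurable_fun_homo_in; first exact: interval_is_interval.
by move=> s t; rewrite !inE/=; exact: quantile_nondecreasing.
Qed.

Let q0 : R -> R := q \_ `]0, 1[.
Let m01 : measurable (`]0, 1[ : set R). Proof. by []. Qed.
Let mq0 : measurable_fun setT q0.
Proof. by apply/(measurable_restrictT _ m01); exact: quantile_measurable. Qed.
(** The two measures agree on the rays unbounded to the right, by the Galois
    connection. *)
Lemma quantile_lawT A : measurable A ->
  pushforward (mrestr mu m01) q0 A = distribution P X A.
Proof.
pose m2 : {measure set R -> \bar R} := pushforward (mrestr mu m01) q0.
rewrite -[LHS]/(m2 mq0 A).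
apply: (measure_unique (@RGenOInfty.G R) (fun n => `](- n%:R), +oo[%classic)).
- exact: RGenOInfty.measurableE.
- move=> _ _ [x ->] [y ->]; exists (Num.max x y).
  by apply/seteqP; split => z /=; rewrite !in_itv/= !andbT gt_max => /andP.
- by move=> n; exists (- n%:R).
- rewrite -subTset => x _; exists (Num.truncn `|x|).+1 => //=.
  rewrite in_itv/= andbT ltrNl (le_lt_trans (ler_norm _))// normrN.
  by case/andP: (truncn_itv (normr_ge0 x)).
- move=> _ [x ->] /=; rewrite /pushforward/= /mrestr.
  rewrite (_ : _ `&` _ = `](F x), 1[%classic); last first.
    apply/seteqP; split => t/=.
      rewrite !in_itv/= andbT /q0 => -[+ t01]; rewrite patchE mem_set/= ?in_itv//.
      by rewrite ltNge quantileP ?in_itv// -ltNge => ->; case/andP: t01.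
    rewrite !in_itv/= andbT /q0 => /andP[Ft t1].
    have t0 : 0 < t by rewrite (le_lt_trans (dfun_ge0 x)).
    rewrite t0 t1; split => //; rewrite patchE mem_set/= ?in_itv/= ?t0//.
    by rewrite ltNge quantileP ?in_itv/= ?t0// -ltNge.
  rewrite lebesgue_measure_itv/= lte_fin.
  have -> : distribution P X `]x, +oo[ = (1 - F x)%:E.
    by have := ccdf_1_cdf X x; rewrite /ccdf => ->; rewrite dfunE.
  case: ltP => // F1; congr EFin; apply/eqP; rewrite eq_sym subr_eq0 eq_le F1.
  exact: dfun_le1.
- move=> n /=; rewrite /pushforward/= /mrestr.
  apply: (@le_lt_trans _ _ (mu `]0%R, 1%R[)); last first.
    by rewrite lebesgue_measure_itv/= lte01 -EFinB ltry.
  apply: le_measure; rewrite ?inE//.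
  by apply: measurableI => //; rewrite -[X in measurable X]setTI; exact: mq0.
Qed.

Lemma quantile_law (f : R -> \bar R) :
  measurable_fun setT f -> (forall x, 0 <= f x)%E ->
  (\int[P]_w f (X w) = \int[mu]_(t in `]0%R, 1%R[) f (q t))%E.
Proof.
move=> mf f0; have mfq : measurable_fun setT (f \o q0) by exact: measurableT_comp.
rewrite -(ge0_integral_distribution X)//.
transitivity (\int[mrestr mu m01]_t (f \o q0) t)%E; last first.
  rewrite ge0_integral_mrestr//; last by move=> x; exact: f0.
  by apply: eq_integral => t; rewrite inE/= => t01; rewrite /q0 patchE mem_set.
rewrite -[setT in RHS](preimage_setT q0) -ge0_integral_pushforward//.
by apply: eq_measure_integral => A mA _; apply: esym; exact: quantile_lawT.
Qed.

Lemma quantile_law_set (A : set R) : measurable A ->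
  mu (`]0, 1[ `&` (q @^-1` A)) = P (X @^-1` A).
Proof.
move=> mA; rewrite -[RHS](quantile_lawT mA) /pushforward/= /mrestr.
congr (mu _); apply/seteqP; split=> t/=.
  by move=> [t01 qA]; split => //; rewrite /q0 patchE mem_set.
by rewrite /q0 => -[+ t01]; rewrite patchE mem_set.
Qed.

Definition upper_set (U : set R) := forall x y, U x -> x <= y -> U y.

Lemma upper_set_measurable U : upper_set U -> measurable U.
Proof.
move=> uU; apply: is_interval_measurable => x y Ux Uy z /andP[xz _].
exact: uU xz.
Qed.

(** The point of [0, 1] at which the quantile function enters the upper set. *)
Definition level (U : set R) : R := fine (P (X @^-1` ~` U)).

Lemma levelE U : upper_set U -> P (X @^-1` ~` U) = (level U)%:E.
Proof.
move=> /upper_set_measurable mU; rewrite /level fineK// fin_num_measure//.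
exact/measurable_funPTI/measurableC.
Qed.

Lemma level_itv U : upper_set U -> level U \in `[0, 1].
Proof.
move=> uU; rewrite in_itv/= -!lee_fin -levelE// measure_ge0 probability_le1//.
by apply: measurable_funPTI; apply: measurableC; exact: upper_set_measurable.
Qed.

(** The quantile function is nondecreasing, so it enters [U] once; it spends a
    time [1 - level X U] in [U], because it transports Lebesgue measure to the
    law of [X]. *)
Lemma quantile_upper_set U t : upper_set U -> t \in `]0, 1[ ->
  (level U < t -> U (q t)) /\ (t < level U -> ~ U (q t)).
Proof.
move=> uU t01; have mU := upper_set_measurable uU.
have /andP[t0 t1] : 0 < t < 1 by rewrite in_itv/= in t01.
have PU : mu (`]0, 1[ `&` (q @^-1` U)) = (1 - level U)%:E.
  rewrite quantile_law_set// -[U in LHS]setCK preimage_setC probability_setC.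
    by rewrite levelE.
  exact: (measurable_funPTI X (measurableC mU)).
have mV : measurable (`]0, 1[ `&` (q @^-1` U)).
  exact: (quantile_measurable m01).
split=> tU.
  apply: contrapT => nUt.
  have : (mu (`]0%R, 1%R[ `&` (q @^-1` U)) <= mu `]t, 1%R[)%E.
    apply: le_measure; rewrite ?inE// => s /= [s01 Us].
    rewrite in_itv/=; move: (s01); rewrite in_itv/= => /andP[_ ->].
    rewrite andbT ltNge; apply/negP => st; apply: nUt.
    by apply: uU Us _; exact: quantile_nondecreasing.
  rewrite PU lebesgue_measure_itv/= lte_fin t1 -EFinB lee_fin; lra.
move=> Ut.
have : (mu `[t, 1%R[ <= mu (`]0%R, 1%R[ `&` (q @^-1` U)))%E.
  apply: le_measure; rewrite ?inE// => s /=; rewrite in_itv/= => /andP[ts s1].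
  have s01 : s \in `]0, 1[ by rewrite in_itv/= s1 (lt_le_trans t0).
  by split => //; apply: uU Ut _; exact: quantile_nondecreasing.
rewrite PU lebesgue_measure_itv/= lte_fin t1 -EFinB lee_fin; lra.
Qed.

Lemma integral_upper_set (f : R -> \bar R) U : upper_set U ->
  measurable_fun (`]0, 1[ : set R) f ->
  (\int[mu]_(t in `]0%R, 1%R[ `&` (q @^-1` U)) f t =
   \int[mu]_(t in `](level U), 1%R[) f t)%E.
Proof.
move=> uU mf; have mU := upper_set_measurable uU.
have /andP[u0 u1] : 0 <= level U <= 1 by have := level_itv uU; rewrite in_itv.
have mV : measurable (`]0, 1[ `&` (q @^-1` U)).
  exact: (quantile_measurable m01).
rewrite -(@integral_setD1 _ _ (level U)); last 2 first.
- exact: measurableD.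
- by apply: measurable_funS mf => // t [[]].
congr (integral _ _ _); apply/seteqP; split=> t /=.
  move=> [[t01 Ut] tu]; have [_ tl] := quantile_upper_set uU t01.
  move: (t01); rewrite !in_itv/= => /andP[_ ->]; rewrite andbT lt_neqAle.
  rewrite eq_sym; apply/andP; split; first exact/eqP.
  by rewrite leNgt; apply/negP => /tl.
rewrite in_itv/= => /andP[ut t1].
have t01 : t \in `]0, 1[ by rewrite in_itv/= t1 (le_lt_trans u0).
have [tu _] := quantile_upper_set uU t01.
by split; [split => //; exact: tu|apply/eqP; rewrite gt_eqF].
Qed.

End quantile_transform.

(** * Flat pieces of the quantile function *)

Section fibers.
Context {d} {T : measurableType d} {R : realType} {P : probability T R}.
Variable X : {RV P >-> R}.
Local Notation mu := (@lebesgue_measure R).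
Local Notation F := (dfun X).
Local Notation q := (quantile X).

(** [P[X < x]], which is the left limit of the distribution function at [x]. *)
Definition dfunl (x : R) : R := level X `[x, +oo[.
Local Notation Fl := dfunl.

Lemma upper_set_cy (x : R) : upper_set `[x, +oo[.
Proof. by move=> y z /=; rewrite !in_itv/= !andbT; exact: le_trans. Qed.

Lemma upper_set_oy (x : R) : upper_set `]x, +oo[.
Proof. by move=> y z /=; rewrite !in_itv/= !andbT; exact: lt_le_trans. Qed.

Lemma level_oy x : level X `]x, +oo[ = F x.
Proof. by rewrite /level /dfun /cdf /distribution/= /pushforward setCitvr. Qed.

Lemma level_anti (U V : set R) : upper_set U -> upper_set V -> U `<=` V ->
  level X V <= level X U.
Proof.
move=> uU uV UV; rewrite -lee_fin -!levelE//; apply: le_measure; rewrite ?inE.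
- exact: (measurable_funPTI X (measurableC (upper_set_measurable uV))).
- exact: (measurable_funPTI X (measurableC (upper_set_measurable uU))).
- by move=> w /= nV /UV.
Qed.

Lemma dfunl_ge0 x : 0 <= Fl x.
Proof. by have := level_itv X (@upper_set_cy x); rewrite in_itv => /andP[]. Qed.

Lemma dfunl_le x : Fl x <= F x.
Proof.
rewrite -level_oy; apply: level_anti; [exact: upper_set_oy|exact: upper_set_cy|].
by move=> y /=; rewrite !in_itv/= !andbT; exact: ltW.
Qed.

Lemma dfun_le_dfunl x y : x < y -> F x <= Fl y.
Proof.
move=> xy; rewrite -level_oy; apply: level_anti; [exact: upper_set_cy|exact: upper_set_oy|].
by move=> z /=; rewrite !in_itv/= !andbT; exact: lt_le_trans.
Qed.

Lemma dfunl_nondecreasing : {homo Fl : x y / x <= y}.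
Proof.
move=> x y; rewrite le_eqVlt => /predU1P[->//|xy].
by rewrite (le_trans (dfunl_le x))// dfun_le_dfunl.
Qed.

Lemma dfunl_quantile t : t \in `]0, 1[ -> Fl (q t) <= t <= F (q t).
Proof.
move=> t01; rewrite -quantileP// lexx andbT leNgt; apply/negP => tF.
have [_ /(_ tF)] := quantile_upper_set X (@upper_set_cy (q t)) t01.
by apply; rewrite /= in_itv/= lexx.
Qed.

Lemma quantile_between t x : t \in `]0, 1[ -> Fl x < t < F x -> q t = x.
Proof.
move=> t01 /andP[Flt tF]; apply/eqP; rewrite eq_le quantileP// (ltW tF)/=.
have [/(_ Flt) + _] := quantile_upper_set X (@upper_set_cy x) t01.
by rewrite /= in_itv/= andbT.
Qed.

(** If the distribution function stayed below some [t < P[X < x]] to the left of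
    [x], then the quantile function would take values in [[x, +oo[] on a set
    larger than the probability of this ray allows. *)
Lemma cvg_dfun_left x : F y @[y --> x^'-] --> Fl x.
Proof.
apply/cvgrPdist_lt => e e0.
have [y0 y0x Hy0] : exists2 y0, y0 < x & Fl x - e < F y0.
  have [Fe|Fe] := ltP (Fl x) e.
    by exists (x - 1); [rewrite ltrBlDr ltrDl|rewrite (lt_le_trans _ (dfun_ge0 _ _))// subr_lt0].
  pose t := Fl x - e / 2.
  have Fx1 : Fl x <= 1 by rewrite (le_trans (dfunl_le x))// dfun_le1.
  have t01 : t \in `]0, 1[ by rewrite in_itv/= /t; apply/andP; split; lra.
  have tF : t < Fl x by rewrite /t; lra.
  have [_ /(_ tF)] := quantile_upper_set X (@upper_set_cy x) t01.
  rewrite /= in_itv/= andbT => /negP; rewrite -ltNge => qx.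
  exists (q t) => //; rewrite (@lt_le_trans _ _ t)//; first by rewrite /t; lra.
  by rewrite -quantileP.
near=> y.
have yx : y < x by near: y; exact: nbhs_left_lt.
have y0y : y0 < y by near: y; exact: nbhs_left_gt.
have := dfun_le_dfunl yx; have := dfun_nondecreasing X (ltW y0y) => h1 h2.
rewrite ger0_norm ?subr_ge0//; lra.
Unshelve. all: by end_near. Qed.

Lemma continuous_dfunP x : {for x, continuous F} <-> Fl x = F x.
Proof.
split=> [/left_right_continuousP[Fx _]|FE].
  exact: (cvg_unique _ (@cvg_dfun_left x) Fx).
apply/left_right_continuousP; split; last exact: dfun_right_continuous.
by rewrite -FE; exact: cvg_dfun_left.
Qed.

Lemma fiber_measure x :
  P (X @^-1` [set x]) = 0 -> Fl x = F x.
Proof.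
move=> Px; apply/eqP; rewrite eq_le dfunl_le/= leNgt; apply/negP => FF.
have : (mu `](Fl x), (F x)[ <= P (X @^-1` [set x]))%E.
  rewrite -quantile_law_set//; apply: le_measure; rewrite ?inE//.
    by apply: (quantile_measurable X) => //; exact: measurable_itv.
  move=> t /=; rewrite in_itv/= => /andP[t1 t2].
  have t01 : t \in `]0, 1[.
    by rewrite in_itv/= (le_lt_trans (dfunl_ge0 x) t1) (lt_le_trans t2)// dfun_le1.
  by split => //; apply: quantile_between => //; rewrite t1.
rewrite Px lebesgue_measure_itv/= lte_fin FF -EFinB lee_fin; lra.
Qed.

(** Conditioning on the quantile function: off its flat pieces it determines the
    point of [(0, 1)], so only the mean over each flat piece matters. *)
Lemma integral_fiberwise (h1 h2 : R -> \bar R) (B : set R) : measurable B ->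
  measurable_fun (`]0, 1[ : set R) h1 -> measurable_fun (`]0, 1[ : set R) h2 ->
  {in `]0, 1[, forall t, (0 <= h1 t)%E} -> {in `]0, 1[, forall t, (0 <= h2 t)%E} ->
  (forall t, t \in `]0, 1[ -> Fl (q t) = F (q t) -> h1 t = h2 t) ->
  (forall x, (Fl x < F x)%R -> \int[mu]_(t in `]0%R, 1%R[ `&` q @^-1` [set x]) h1 t =
    \int[mu]_(t in `]0%R, 1%R[ `&` q @^-1` [set x]) h2 t)%E ->
  (\int[mu]_(t in `]0%R, 1%R[ `&` q @^-1` B) h1 t =
   \int[mu]_(t in `]0%R, 1%R[ `&` q @^-1` B) h2 t)%E.
Proof.
move=> mB mh1 mh2 h10 h20 h12 hx.
have mpre C : measurable C -> measurable (`]0, 1[ `&` q @^-1` C).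
  by move=> mC; apply: (quantile_measurable X) => //; exact: measurable_itv.
(* the values of the flat pieces are the atoms of the law, which are
   countable; [e] numbers them *)
pose A := [set x | 0 < pmf X x].
have cA : countable A := pmf_gt0_countable X.
have mA : measurable A by exact: countable_measurable.
have /countable_injP[e einj] := cA.
pose G n := (`]0, 1[ `&` q @^-1` (B `&` A `&` e @^-1` [set n])) : set R.
have GE n : B `&` A `&` e @^-1` [set n] = set0 \/
    exists2 x, A x & B `&` A `&` e @^-1` [set n] = [set x].
  have [->|/set0P[x [[Bx Ax] ex]]] := eqVneq (B `&` A `&` e @^-1` [set n]) set0.
    by left.
  right; exists x => //; apply/seteqP; split=> [y [[By Ay] ey]|y /= ->//].
  by apply: einj; rewrite ?inE//= ey.
have mG n : measurable (G n).
  by apply: mpre; have [->|[x _ ->]] := GE n.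
have tG : trivIset setT G.
  by move=> i j _ _ [t [[_ [_ /= <-]] [_ [_ /= <-]]]].
have UG : `]0, 1[ `&` q @^-1` B = (`]0, 1[ `&` q @^-1` (B `\` A)) `|` \bigcup_n G n.
  apply/seteqP; split=> [t [t01 Bt]|t [[t01 [Bt _]]//|[n _ [t01 [[Bt _] _]]]//]].
  have [At|nAt] := pselect (A (q t)); last by left.
  by right; exists (e (q t)).
have mUG : measurable (\bigcup_n G n) by exact: bigcup_measurable.
have dG : [disjoint (`]0, 1[ `&` q @^-1` (B `\` A)) & \bigcup_n G n].
  by apply/disj_setPS => t [[_ [_ nA]] [n _ [_ [[_ At] _]]]].
have mD : measurable (`]0, 1[ `&` q @^-1` (B `\` A)).
  by apply: mpre; exact: measurableD.
have sub1 : `]0, 1[ `&` q @^-1` B `<=` (`]0, 1[ : set R) by exact: subIsetl.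
have sub2 : \bigcup_n G n `<=` (`]0, 1[ : set R) by move=> t [n _ []].
have splitE h : measurable_fun (`]0, 1[ : set R) h ->
    {in `]0, 1[, forall t, (0 <= h t)%E} ->
  (\int[mu]_(t in `]0%R, 1%R[ `&` q @^-1` B) h t =
   \int[mu]_(t in `]0%R, 1%R[ `&` q @^-1` (B `\` A)) h t +
   \sum_(n <oo) \int[mu]_(t in G n) h t)%E.
  move=> mh h0; rewrite UG ge0_integral_setU//.
  - by rewrite ge0_integral_bigcup//;
      [apply: measurable_funS mh|move=> t /sub2; exact: h0].
  - by apply: measurable_funS mh => //; rewrite -UG.
  - by move=> t; rewrite -UG => /sub1; exact: h0.
rewrite !splitE//; congr (_ + _)%E.
  apply: eq_integral => t; rewrite inE => -[t01 [Bt nAt]]; apply: h12 => //.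
  apply: fiber_measure; apply/eqP; rewrite eq_le measure_ge0 andbT.
  rewrite leNgt; apply/negP => P0; apply: nAt; rewrite /A/= /pmf fine_gt0// P0/=.
  by rewrite -ge0_fin_numE ?fin_num_measure//; exact: measurable_funPTI.
apply: eq_eseriesr => n _; rewrite /G; have [->|[x Ax ->]] := GE n.
  by rewrite preimage_set0 setI0 !integral_set0.
have [FF|FF] := ltP (Fl x) (F x); first exact: hx.
apply: eq_integral => t; rewrite inE => -[t01 /= qt]; apply: h12 => //.
by apply/eqP; rewrite eq_le dfunl_le qt FF.
Qed.

Lemma integral_fiber (h : R -> \bar R) x : measurable_fun (`]0, 1[ : set R) h ->
  (\int[mu]_(t in `]0%R, 1%R[ `&` q @^-1` [set x]) h t =
   \int[mu]_(t in `](Fl x), (F x)[) h t)%E.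
Proof.
move=> mh.
have mpre : measurable (`]0, 1[ `&` q @^-1` [set x]).
  by apply: (quantile_measurable X) => //; exact: measurable_itv.
have mE : measurable ((`]0, 1[ `&` q @^-1` [set x]) `\ F x) by exact: measurableD.
rewrite -(@integral_setD1 _ _ (F x))//; last first.
  by apply: measurable_funS mh => // t [[]].
rewrite -(@integral_setD1 _ _ (Fl x))//; last 2 first.
  exact: measurableD.
  by apply: measurable_funS mh => // t [[[]]].
congr (integral _ _ _); apply/seteqP; split=> t.
  move=> [[[t01 /= qt] /eqP tF] /eqP tFl] /=.
  have := dfunl_quantile t01; rewrite qt in_itv/= => /andP[h1 h2].
  by rewrite !lt_neqAle h1 h2 tF eq_sym tFl.
rewrite /= in_itv/= => /andP[h1 h2].
have t01 : t \in `]0, 1[.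
  by rewrite in_itv/= (le_lt_trans (dfunl_ge0 x) h1) (lt_le_trans h2)// dfun_le1.
split; [split; [split => //|]|]; [|by apply/eqP; rewrite lt_eqF|by apply/eqP; rewrite gt_eqF].
by apply: quantile_between => //; rewrite h1.
Qed.

End fibers.

(** * The density g_k *)

Section np_density.
Context {d} {T : measurableType d} {R : realType} {P : probability T R}.
Variables (phi : {RV P >-> R}) (k : R -> R).
Local Notation mu := (@lebesgue_measure R).
Local Notation F := (dfun phi).
Local Notation Fl := (dfunl phi).
Local Notation q := (quantile phi).
Local Notation g := (g_of k phi).

Lemma weight_density : density_weight k -> weight k.
Proof.
move=> [k0 knd _ k1].
have sub t : t \in `]0, 1[ -> t \in `[0, 1[.
  by rewrite !in_itv/= => /andP[/ltW -> ->].
split; [by move=> t /sub; exact: k0|by move=> s t /sub s1 /sub t1; exact: knd|].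
rewrite -k1 integral_itv_obnd_cbnd//; apply/measurable_EFinP.
apply: measurable_fun_homo_in; first exact: interval_is_interval.
by move=> s t; rewrite !inE/= => /sub s1 /sub t1; exact: knd.
Qed.

Hypothesis wk : weight k.

Lemma g_ofE x : g x = if Fl x == F x then k (F x) else
  (F x - Fl x)^-1 * (tail k (Fl x) - tail k (F x)).
Proof.
rewrite /g_of (cvg_lim _ (@cvg_dfun_left _ _ _ _ phi x))//.
have -> : `[< {for x, continuous F} >] = (Fl x == F x).
  by apply/asboolP/eqP => /continuous_dfunP.
case: ifPn => // FF; congr (_ * _).
rewrite tailB ?dfunl_ge0 ?dfunl_le ?dfun_le1// /Rintegral; congr fine.
rewrite (@integral_itv_bndoo _ (Fl x) (F x))//; apply/measurable_EFinP.
apply: measurable_funS (weight_measurable wk) => //.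
move=> t /=; rewrite !in_itv/= => /andP[h1 h2].
by rewrite (le_lt_trans (dfunl_ge0 _ _) h1) (lt_le_trans h2)// dfun_le1.
Qed.

(** This interval carries the law of [phi].  Outside of it [g_k] equals [k 0] or
    [k 1], and [k 1] is arbitrary; so monotonicity and positivity of [g_k] can
    only hold inside. *)
Definition bulk : set R := [set x | 0 < F x /\ Fl x < 1].

Lemma bulk_quantile t : t \in `]0, 1[ -> bulk (q t).
Proof.
move=> t01; have /andP[h1 h2] := dfunl_quantile phi t01.
by move: t01; rewrite in_itv/= => /andP[t0 t1]; split; lra.
Qed.

Lemma bulk_interval : is_interval bulk.
Proof.
move=> x y [Fx _] [_ Fy] z /andP[xz zy]; split.
  exact: lt_le_trans (dfun_nondecreasing phi xz).
exact: le_lt_trans (dfunl_nondecreasing phi zy) _.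
Qed.

Lemma bulk_measurable : measurable bulk.
Proof. by apply: is_interval_measurable; exact: bulk_interval. Qed.

Lemma ae_bulk : {ae P, forall w, bulk (phi w)}.
Proof.
exists (phi @^-1` (~` bulk)); split => //.
- exact: (measurable_funPTI phi (measurableC bulk_measurable)).
- rewrite -quantile_law_set; last by apply: measurableC; exact: bulk_measurable.
  rewrite (_ : _ `&` _ = set0) ?measure0//.
  by apply/seteqP; split => // t [t01] /=; apply; exact: bulk_quantile.
Qed.

Let k0 := let: And3 h _ _ := wk in h.
Let knd := let: And3 _ h _ := wk in h.

Lemma g_of_ge0 x : bulk x -> 0 <= g x.
Proof.
move=> [Fx Flx]; rewrite g_ofE; case: eqP => [FE|_].
  by apply: k0; rewrite in_itv/= Fx -FE.
rewrite mulr_ge0 ?invr_ge0 ?subr_ge0 ?dfunl_le//.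
by apply: tail_nonincreasing; rewrite ?dfunl_ge0 ?dfunl_le ?dfun_le1.
Qed.

Let g_of_le x : bulk x -> F x < 1 -> g x <= k (F x).
Proof.
move=> [Fx Flx] Fx1; rewrite g_ofE; case: eqP => // FE.
have FF : Fl x < F x by rewrite lt_neqAle dfunl_le andbT; exact/eqP.
rewrite mulrC ler_pdivrMr ?subr_gt0// lerBlDr addrC.
by apply: tail_supergradient; rewrite // in_itv/= ?Fx ?dfunl_ge0// ltW.
Qed.

Let g_of_ge x : bulk x -> 0 < Fl x -> k (Fl x) <= g x.
Proof.
move=> [Fx Flx] Fl0; rewrite g_ofE; case: eqP => [->//|FE].
have FF : Fl x < F x by rewrite lt_neqAle dfunl_le andbT; exact/eqP.
rewrite [leRHS]mulrC ler_pdivlMr ?subr_gt0// lerBrDr addrC -lerBrDr -mulrN opprB.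
by apply: tail_supergradient; rewrite // in_itv/= ?Fl0// dfun_ge0 dfun_le1.
Qed.

(** On both sides of a gap [F x <= Fl y] the function [g_k] is compared with [k]:
    an average of [k] over [[Fl x, F x]] is at most [k (F x)], and an average
    over [[Fl y, F y]] is at least [k (Fl y)]. *)
Lemma g_of_nondecreasing : {in bulk &, {homo g : x y / x <= y}}.
Proof.
move=> x y; rewrite !inE => Cx Cy; rewrite le_eqVlt => /predU1P[->//|xy].
have [Fx _] := Cx; have [_ Fly] := Cy; have FF := dfun_le_dfunl phi xy.
apply: (le_trans (g_of_le Cx (le_lt_trans FF Fly))).
apply: (@le_trans _ _ (k (Fl y))); last by apply: g_of_ge => //; exact: lt_le_trans FF.
by apply: knd => //; rewrite in_itv/=; apply/andP; split; lra.
Qed.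

Lemma g_of_measurable : measurable_fun setT g.
Proof.
have uF : upper_set [set x | 0 < F x].
  by move=> x y /= Fx xy; exact: lt_le_trans (dfun_nondecreasing phi xy).
have uFl : upper_set [set x | 1 <= Fl x].
  by move=> x y /= Fx xy; exact: le_trans (dfunl_nondecreasing phi xy).
have -> : [set: R] = (bulk `|` ~` [set x | 0 < F x]) `|` [set x | 1 <= Fl x].
  apply/seteqP; split=> // x _ /=.
  have [F0|F0] := ltP 0 (F x); last by left; right.
  by have [F1|F1] := ltP (Fl x) 1; [left; left|right].
have mF := measurableC (upper_set_measurable uF).
have mFl := upper_set_measurable uFl; have mc := bulk_measurable.
apply/measurable_funU => //; first exact: measurableU.
split; first (apply/measurable_funU => //; split).
- apply: measurable_fun_homo_in bulk_interval _ => x y; exact: g_of_nondecreasing.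
- apply: (eq_measurable_fun (cst (k 0))) => // x; rewrite inE/= => /negP.
  rewrite -leNgt => F0; have FE : F x = 0 by apply/eqP; rewrite eq_le F0 dfun_ge0.
  have FlE : Fl x = 0 by apply/eqP; rewrite eq_le dfunl_ge0 -{1}FE dfunl_le.
  by rewrite g_ofE FE FlE eqxx.
- apply: (eq_measurable_fun (cst (k 1))) => // x; rewrite inE/= => Fl1.
  have FE : F x = 1.
    by apply/eqP; rewrite eq_le dfun_le1 (le_trans Fl1)// dfunl_le.
  have FlE : Fl x = 1 by apply/eqP; rewrite eq_le Fl1 -{1}FE dfunl_le.
  by rewrite g_ofE FE FlE eqxx.
Qed.

(** [g_k] of the quantile is the conditional expectation of [k] given the
    quantile. *)
Lemma integral_g_of_quantile B : measurable B ->
  (\int[mu]_(t in `]0%R, 1%R[ `&` q @^-1` B) (g (q t))%:E =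
   \int[mu]_(t in `]0%R, 1%R[ `&` q @^-1` B) (k t)%:E)%E.
Proof.
have mk : measurable_fun (`]0, 1[ : set R) (EFin \o k).
  by apply/measurable_EFinP; exact: weight_measurable.
have mgq : measurable_fun (`]0, 1[ : set R) (fun t => (g (q t))%:E).
  apply/measurable_EFinP; apply: (measurableT_comp g_of_measurable).
  exact: quantile_measurable.
move=> mB; apply: (integral_fiberwise (X := phi)) => //.
- by move=> t t01; rewrite lee_fin g_of_ge0//; exact: bulk_quantile.
- move=> t t01 FE; rewrite g_ofE FE eqxx.
  have := dfunl_quantile phi t01; rewrite FE -eq_le => /eqP Ft.
  by rewrite Ft.
move=> x FF.
transitivity (\int[mu]_(t in `](Fl x), (F x)[) (k t)%:E)%E; last first.
  by rewrite (@integral_fiber _ _ _ _ phi (EFin \o k)).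
transitivity (\int[mu]_(t in `]0%R, 1%R[ `&` q @^-1` [set x]) (g x)%:E)%E.
  by apply: eq_integral => t; rewrite inE => -[_ /= ->].
rewrite (@integral_fiber _ _ _ _ phi (cst (g x)%:E)); last exact: measurable_cst.
rewrite integral_cst//= lebesgue_measure_itv/= lte_fin FF -EFinB -EFinM.
rewrite g_ofE lt_eqF// mulrAC mulVf ?subr_eq0 ?gt_eqF// mul1r.
rewrite tailB ?dfunl_ge0 ?dfunl_le ?dfun_le1// /Rintegral fineK//.
apply: integrable_fin_num => //.
apply: integrableS (weight_integrable wk) => //.
move=> t /=; rewrite !in_itv/= => /andP[h1 h2].
by rewrite (le_lt_trans (dfunl_ge0 _ _) h1) (lt_le_trans h2)// dfun_le1.
Qed.

(** Change of variables by the quantile transform for a function of the price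
    density which is nonnegative on the bulk only. *)
Lemma integral_upper_set_ae (w : R -> R) U : upper_set U ->
  measurable_fun setT w -> (forall x, bulk x -> 0 <= w x) ->
  (\int[P]_(x in phi @^-1` U) (w (phi x))%:E =
   \int[mu]_(t in `]0%R, 1%R[ `&` q @^-1` U) (w (q t))%:E)%E.
Proof.
move=> uU mw w0; have mU := upper_set_measurable uU.
have mCU : measurable (bulk `&` U) by apply: measurableI => //; exact: bulk_measurable.
pose w1 : R -> R := w \_ (bulk `&` U).
have mw1 : measurable_fun setT w1.
  by apply/(measurable_restrictT _ mCU); exact: measurable_funS mw.
transitivity (\int[P]_x (w1 (phi x))%:E)%E.
  rewrite integral_mkcond; apply: ae_eq_integral => //.
  - apply/(measurable_restrictT _ (measurable_funPTI phi mU)).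
    apply/measurable_EFinP; apply: measurable_funTS.
    exact: measurableT_comp.
  - by apply/measurable_EFinP; exact: measurableT_comp.
  apply: filterS ae_bulk => x Cx _; rewrite patchE /w1 patchE.
  have -> : (x \in phi @^-1` U) = (phi x \in U) by apply/idP/idP; rewrite !inE.
  by rewrite in_setI mem_set//=; case: ifP.
rewrite (quantile_law phi (f := EFin \o w1)); last 2 first.
- exact/measurable_EFinP.
- by move=> x; rewrite lee_fin /w1 patchE; case: ifPn => // /set_mem[/w0].
rewrite integral_mkcondr; apply: eq_integral => t; rewrite inE/= => t01.
rewrite patchE /w1/= patchE.
have -> : (t \in q @^-1` U) = (q t \in U) by apply/idP/idP; rewrite !inE.
by rewrite in_setI (mem_set (bulk_quantile t01))/=; case: ifP.
Qed.

(** The objective of the increasing problem at an indicator is [rho_k] of this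
    indicator. *)
Lemma expectation_g_of_upper U : upper_set U ->
  (\int[P]_(w in phi @^-1` U) (g (phi w))%:E = (tail k (level phi U))%:E)%E.
Proof.
move=> uU; rewrite (integral_upper_set_ae uU g_of_measurable g_of_ge0).
rewrite integral_g_of_quantile; last exact: upper_set_measurable.
rewrite (@integral_upper_set _ _ _ _ phi (EFin \o k))//; last first.
  by apply/measurable_EFinP; exact: weight_measurable.
by rewrite tailE//; have := level_itv phi uU; rewrite in_itv => /andP[].
Qed.

End np_density.

(** * The Neyman-Pearson lemma *)

Section neyman_pearson.
Context {d} {T : measurableType d} {R : realType} {P : probability T R}.
Variable phi : {RV P >-> R}.
Local Notation mu := (@lebesgue_measure R).
Local Notation F := (dfun phi).
Local Notation Fl := (dfunl phi).
Local Notation q := (quantile phi).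
Hypothesis phi_gt0 : {ae P, forall w, 0 < phi w}.
Hypothesis phi_mean : ('E_P[phi] = 1)%E.

(** The price density is positive only almost surely; this version is
    nonnegative everywhere, as Tonelli's theorem requires. *)
Definition pos_part w : R := Num.max (phi w) 0.
Local Notation psi := pos_part.

Lemma pos_part_ge0 w : 0 <= psi w. Proof. by rewrite le_max lexx orbT. Qed.
Hint Resolve pos_part_ge0 : core.

Lemma pos_part_measurable : measurable_fun setT psi.
Proof. by apply: measurable_maxr => //; exact: measurable_cst. Qed.

Lemma ae_pos_part : {ae P, forall w, psi w = phi w}.
Proof. by apply: filterS phi_gt0 => w; rewrite /psi => /ltW /max_l. Qed.

Lemma integral_pos_part A : measurable A ->
  (\int[P]_(w in A) (phi w)%:E = \int[P]_(w in A) (psi w)%:E)%E.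
Proof.
move=> mA; apply: ae_eq_integral => //.
- by apply/measurable_EFinP; exact: measurable_funTS.
- by apply/measurable_EFinP/measurable_funTS; exact: pos_part_measurable.
- by apply: filterS ae_pos_part => w ->.
Qed.

Lemma integral_pos_partT : (\int[P]_w (psi w)%:E = 1)%E.
Proof. by rewrite -integral_pos_part// -phi_mean expectation_def. Qed.

Lemma dfun_le0 x : x <= 0 -> F x = 0.
Proof.
move=> x0; have [N [mN N0 sN]] := phi_gt0.
apply/eqP; rewrite eq_le dfun_ge0 andbT -lee_fin -dfunE.
rewrite (_ : 0%:E = P N)//.
rewrite /cdf /distribution/= /pushforward.
apply: le_measure; rewrite ?inE//; first exact: measurable_funPTI.
move=> w /=; rewrite in_itv/= => wx; apply: sN => /=; apply/negP.
by rewrite -leNgt (le_trans wx).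
Qed.

Lemma dfun_gt0 x : 0 < F x -> 0 < x.
Proof. by move=> Fx; rewrite ltNge; apply/negP => /dfun_le0 F0; rewrite F0 ltxx in Fx. Qed.

Lemma quantile_gt0 t : t \in `]0, 1[ -> 0 < q t.
Proof.
move=> t01; rewrite ltNge quantileP// dfun_le0// -ltNge.
by move: t01; rewrite in_itv => /andP[].
Qed.

Lemma quantile_weight : weight q.
Proof.
split; [by move=> t /quantile_gt0/ltW|exact: quantile_nondecreasing|].
rewrite -integral_pos_partT.
rewrite (quantile_law phi (f := fun x => (Num.max x 0)%:E)); last 2 first.
- apply/measurable_EFinP; apply: measurable_maxr => //; exact: measurable_cst.
- by move=> x; rewrite lee_fin le_max lexx orbT.
apply: eq_integral => t; rewrite inE/= => /quantile_gt0/ltW q0.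
by rewrite max_l.
Qed.

Lemma integral_pos_part_upper U : upper_set U ->
  (\int[P]_(w in phi @^-1` U) (psi w)%:E = (tail q (level phi U))%:E)%E.
Proof.
move=> uU; rewrite -integral_pos_part; last first.
  exact: (measurable_funPTI phi (upper_set_measurable uU)).
rewrite (@integral_upper_set_ae _ _ _ _ phi id)//; last first.
  by move=> x [/dfun_gt0/ltW].
rewrite (@integral_upper_set _ _ _ _ phi (EFin \o q))//; last first.
  by apply/measurable_EFinP; exact: quantile_measurable.
rewrite (tailE quantile_weight)//.
by have := level_itv phi uU; rewrite in_itv => /andP[].
Qed.

(** The loss of the event [A] against the test that accepts above the threshold
    [a]: it vanishes at [w] exactly when [A] accepts [w] if [phi w > a] and rejects
    it if [phi w < a] (for positive prices). *)
Definition slack (A : set T) (a : R) (w : T) : R :=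
  Num.max (phi w - a) 0 - (psi w - a) * \1_A w.

Lemma slack_ge0 A a w : 0 <= a -> 0 <= slack A a w.
Proof.
move=> a0; rewrite /slack /psi indicE.
have [p0|p0] := leP 0 (phi w).
  case: (_ \in _); rewrite ?mulr1 ?mulr0 ?subr0.
    by rewrite subr_ge0 le_max lexx.
  by rewrite le_max lexx orbT.
rewrite [X in X - _]max_r; last by rewrite subr_le0; lra.
by rewrite !sub0r mulNr opprK mulr_ge0.
Qed.

Lemma slack_measurable A a : measurable A -> measurable_fun setT (slack A a).
Proof.
move=> mA; apply: measurable_funB.
  apply: measurable_maxr; last exact: measurable_cst.
  by apply: measurable_funB => //; exact: measurable_cst.
apply: measurable_funM; last exact: measurable_indic.
by apply: measurable_funB; [exact: pos_part_measurable|exact: measurable_cst].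
Qed.

Let excess_measurable a : measurable_fun setT (fun w => (Num.max (phi w - a) 0)%:E).
Proof.
apply/measurable_EFinP; apply: measurable_maxr; last exact: measurable_cst.
by apply: measurable_funB => //; exact: measurable_cst.
Qed.

Let split_at (A : set T) (a : R) (h : T -> R) : measurable A -> 0 <= a ->
  measurable_fun setT h -> (forall w, 0 <= h w) ->
  (forall w, Num.max (phi w - a) 0 + a * \1_A w = psi w * \1_A w + h w) ->
  (\int[P]_w (Num.max (phi w - a) 0)%:E + a%:E * P A =
   \int[P]_(w in A) (psi w)%:E + \int[P]_w (h w)%:E)%E.
Proof.
move=> mA a0 mh h0 hE.
have -> : (a%:E * P A = \int[P]_w (a * \1_A w)%:E)%E.
  under eq_integral do rewrite EFinM.
  rewrite ge0_integralZl_EFin//; last by apply/measurable_EFinP; exact: measurable_indic.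
  by rewrite integral_indic// setIT.
have -> : (\int[P]_(w in A) (psi w)%:E = \int[P]_w (psi w * \1_A w)%:E)%E.
  rewrite integral_mkcond; apply: eq_integral => w _; rewrite patchE indicE.
  by case: ifPn; rewrite ?mulr1 ?mulr0.
rewrite -ge0_integralD//; last 3 first.
- by move=> w _; rewrite lee_fin le_max lexx orbT.
- by move=> w _; rewrite lee_fin mulr_ge0.
- by apply/measurable_EFinP; apply: measurable_funM; [exact: measurable_cst|exact: measurable_indic].
rewrite -ge0_integralD//.
- by apply: eq_integral => w _; rewrite -!EFinD hE.
- by move=> w _; rewrite lee_fin mulr_ge0.
- by apply/measurable_EFinP; apply: measurable_funM; [exact: pos_part_measurable|exact: measurable_indic].
- by move=> w _; rewrite lee_fin.
- exact/measurable_EFinP.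
Qed.

(** With the threshold [a = q u], the price of any event of probability [1 - u]
    falls short of [tail q u] by the mean of the nonnegative slack.  The price of
    the set [phi > a] is computed by the quantile transform, and [tail q] is affine
    between the level of this set and [u]. *)
Lemma np_slack A u : measurable A -> u \in `]0, 1[ -> P A = (1 - u)%:E ->
  (\int[P]_(w in A) (psi w)%:E + \int[P]_w (slack A (q u) w)%:E =
   (tail q u)%:E)%E.
Proof.
move=> mA u01 PA; have a0 := ltW (quantile_gt0 u01).
rewrite -(@split_at A (q u) (slack A (q u)))//; last 3 first.
- exact: slack_measurable.
- by move=> w; exact: slack_ge0.
- by move=> w; rewrite /slack; ring.
have uU := @upper_set_oy R (q u).
have mU : measurable (phi @^-1` `]q u, +oo[).
  exact: (measurable_funPTI phi (upper_set_measurable uU)).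
have PU : P (phi @^-1` `]q u, +oo[) = (1 - F (q u))%:E.
  by have := ccdf_1_cdf phi (q u); rewrite dfunE -EFinB.
have := @split_at (phi @^-1` `]q u, +oo[) (q u) (fun=> 0) mU a0 (measurable_cst _).
rewrite integral0 adde0 integral_pos_part_upper// level_oy PU PA => H.
have {}H : (\int[P]_w (Num.max (phi w - q u) 0)%:E + (q u)%:E * (1 - F (q u))%:E =
    (tail q (F (q u)))%:E)%E.
  apply: H => // w; rewrite indicE addr0 /psi.
  have -> : (w \in phi @^-1` `]q u, +oo[) = (q u < phi w).
    by apply/idP/idP; rewrite inE/= in_itv/= andbT.
  case: ltP => pq; rewrite ?mulr1 ?mulr0 ?addr0.
    by rewrite !max_l ?subrK ?subr_ge0 ?(ltW pq)// (le_trans a0) ?ltW.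
  by rewrite max_r// subr_le0.
have : (\int[P]_w (Num.max (phi w - q u) 0)%:E)%E \is a fin_num.
  rewrite ge0_fin_numE; last first.
    by apply: integral_ge0 => w _; rewrite lee_fin le_max lexx orbT.
  rewrite (@le_lt_trans _ _ (tail q (F (q u)))%:E) ?ltry// -H leeDl//.
  by rewrite -EFinM lee_fin mulr_ge0// subr_ge0 dfun_le1.
move: H; case: (\int[P]_w _)%E => // r; rewrite -!EFinM -!EFinD => -[rE] _.
have flat : {in `](Fl (q u)), (F (q u))[, forall t, q t = q u}.
  move=> t; rewrite in_itv/= => /andP[h1 h2]; apply: quantile_between; rewrite ?h1//.
  by rewrite in_itv/= (le_lt_trans (dfunl_ge0 _ _) h1) (lt_le_trans h2)// dfun_le1.
have uF : u \in `[(Fl (q u)), (F (q u))] by rewrite in_itv/= dfunl_quantile.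
have [_ tF] := tail_affine quantile_weight (dfunl_ge0 _ _) (dfun_le1 _ _) flat uF.
congr EFin; move: rE; rewrite tF; lra.
Qed.

Lemma np_le A : measurable A ->
  (\int[P]_(w in A) (psi w)%:E <= (tail q (fine (P (~` A))))%:E)%E.
Proof.
move=> mA; have PnA : (fine (P (~` A)))%:E = P (~` A).
  by rewrite fineK// fin_num_measure//; exact: measurableC.
have u0 : 0 <= fine (P (~` A)) by rewrite -lee_fin PnA.
have u1 : fine (P (~` A)) <= 1.
  by rewrite -lee_fin PnA probability_le1//; exact: measurableC.
have PA : P A = (1 - fine (P (~` A)))%:E.
  by rewrite EFinB PnA -probability_setC ?setCK//; exact: measurableC.
move: u0; rewrite le_eqVlt => /predU1P[<-|u0].
  rewrite (tail0 quantile_weight) -integral_pos_partT.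
  apply: ge0_subset_integral => //.
  - by apply/measurable_EFinP; exact: pos_part_measurable.
  - by move=> w _; rewrite lee_fin.
move: u1; rewrite le_eqVlt => /predU1P[uE|u1].
  have PA0 : P A = 0%E by rewrite PA uE subrr.
  rewrite uE tail1 null_set_integral//.
  by apply/measurable_EFinP/measurable_funTS; exact: pos_part_measurable.
rewrite -(np_slack mA _ PA) ?in_itv/= ?u0// leeDl//.
by apply: integral_ge0 => w _; rewrite lee_fin slack_ge0// ltW// quantile_gt0// in_itv/= u0.
Qed.

(** A nonnegative function with mean [0] vanishes almost everywhere. *)
Lemma np_eq A : measurable A -> fine (P (~` A)) \in `]0, 1[ ->
  (\int[P]_(w in A) (psi w)%:E = (tail q (fine (P (~` A))))%:E)%E ->
  {ae P, forall w, (q (fine (P (~` A))) < phi w -> A w) /\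
                   (phi w < q (fine (P (~` A))) -> ~ A w)}.
Proof.
move=> mA u01 AE; have PnA : (fine (P (~` A)))%:E = P (~` A).
  by rewrite fineK// fin_num_measure//; exact: measurableC.
have PA : P A = (1 - fine (P (~` A)))%:E.
  by rewrite EFinB PnA -probability_setC ?setCK//; exact: measurableC.
set u := fine _ in u01 AE PA *; have a0 := ltW (quantile_gt0 u01).
have := np_slack mA u01 PA; rewrite AE => /eqP.
move=> D0'; have D0 : (\int[P]_w (slack A (q u) w)%:E = 0)%E.
  move: D0'; case: (\int[P]_w _)%E => // r; rewrite -EFinD eqe => /eqP; rewrite -[RHS]addr0.
  by move/addrI => ->.
have : ae_eq P setT (fun w => (slack A (q u) w)%:E) (cst 0%E).
  apply/ae_eq_integral_abs => //.
    by apply/measurable_EFinP; exact: slack_measurable.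
  by rewrite -[RHS]D0; apply: eq_integral => w _; rewrite gee0_abs// lee_fin slack_ge0.
move=> H; apply: filterS2 H phi_gt0 => w /(_ I) [] sw pw.
have := sw; rewrite /slack /psi (max_l (ltW pw)) indicE => {}sw; split=> h.
  apply: contrapT => nA; move: sw; rewrite memNset// mulr0 subr0 max_l ?subr_ge0 ?ltW//.
  by move=> /eqP; rewrite subr_eq0 gt_eqF.
move=> Aw; move: sw; rewrite mem_set// mulr1 max_r ?subr_le0 ?ltW// sub0r opprB.
by move=> /eqP; rewrite subr_eq0 gt_eqF.
Qed.

End neyman_pearson.

(** * Supporting lines of the trade-off curve *)

Section lower_hull.
Context {R : realType}.
Variables K L : R -> R.
Hypotheses (cK : {within `[0, 1], continuous K})
  (cL : {within `[0, 1], continuous L}).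
Hypotheses (K0 : K 0 = 1) (K1 : K 1 = 0) (Kgt0 : {in `[0, 1[, forall u, 0 < K u}).
Hypotheses (L0 : L 0 = 1) (L1 : L 1 = 0)
  (Lni : {in `[0, 1] &, {homo L : u s /~ u <= s}}).

Let H (lam u : R) : R := K u - lam * L u.

Let minimizer (a b : R) : 0 <= a -> a <= b -> b <= 1 ->
  exists c : R -> R, forall lam, c lam \in `[a, b] /\
    {in `[a, b], forall u, H lam (c lam) <= H lam u}.
Proof.
move=> a0 ab b1.
suff ex lam : exists c : R, c \in `[a, b] /\
    {in `[a, b], forall u, H lam c <= H lam u} by have [c cP] := choice ex; exists c.
have sab : `[a, b] `<=` (`[0, 1] : set R).
  by move=> t /=; rewrite !in_itv/= => /andP[h1 h2]; rewrite (le_trans a0) ?(le_trans h2).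
have cH : {within `[a, b], continuous (H lam)}.
  apply: continuous_subspaceW sab _ => x; apply: cvgB; first exact: cK.
  by apply: cvgM; [exact: cvg_cst|exact: cL].
by have [c cab cmin] := EVT_min ab cH; exists c.
Qed.

Let L01 u : u \in `[0, 1] -> 0 <= L u <= 1.
Proof.
move=> u01; move: (u01); rewrite in_itv/= => /andP[u0 u1].
by rewrite -L1 -{2}L0 !Lni// in_itv/= lexx ler01.
Qed.

Let lipschitz (a b : R) (c : R -> R) : 0 <= a -> b <= 1 ->
  (forall lam, c lam \in `[a, b] /\
    {in `[a, b], forall u, H lam (c lam) <= H lam u}) ->
  forall x y, `|H x (c x) - H y (c y)| <= `|x - y|.
Proof.
move=> a0 b1 cP.
have half x y : H x (c x) - H y (c y) <= `|x - y|.
  have [cy _] := cP y; have [_ /(_ _ cy) Hx] := cP x.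
  have /L01/andP[l0 l1] : c y \in `[0, 1].
    by move: cy; rewrite !in_itv/= => /andP[h1 h2]; rewrite (le_trans a0) ?(le_trans h2).
  rewrite lerBlDl (le_trans Hx)// /H -subr_ge0.
  have -> : K (c y) - y * L (c y) + `|x - y| - (K (c y) - x * L (c y)) =
    `|x - y| + (x - y) * L (c y) by ring.
  have : - ((x - y) * L (c y)) <= `|x - y|; last by lra.
  by rewrite (le_trans (ler_norm _))// normrN normrM ler_piMr// ger0_norm.
by move=> x y; rewrite ler_norml half lerNl opprB distrC half.
Qed.

(** The curve [u |-> (L u, K u)] has a supporting line from below at abscissa
    [v], touching the curve on both sides of [v].  Minimize [K - lam * L] separately
    over [L <= v] and over [L >= v]: both minima are Lipschitz in [lam], the first
    is the smaller for [lam = 0], the second for [lam] large; so they agree for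
    some slope by the intermediate value theorem.  At [v = 1] the supporting line
    may be vertical. *)
Lemma supporting_line v : 0 < v < 1 ->
  exists lam m u1 u2 : R,
    [/\ 0 < lam, {in `[0, 1], forall u, m <= K u - lam * L u},
        [/\ u1 \in `[0, 1], K u1 - lam * L u1 = m & L u1 <= v] &
        [/\ u2 \in `[0, 1], K u2 - lam * L u2 = m & v <= L u2]].
Proof.
move=> /andP[v0 v1].
have [b b01 Lb] : exists2 b, b \in `[0, 1] & L b = v.
  by apply: IVT => //; rewrite L0 L1 min_r// max_l// !ltW.
move: (b01); rewrite in_itv/= => /andP[b0 b1].
have [c1 c1P] := minimizer b0 b1 (lexx 1).
have [c2 c2P] := minimizer (lexx 0) b0 b1.
(* the difference of the two minima, over [L <= v] and over [L >= v] *)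
pose D lam := H lam (c1 lam) - H lam (c2 lam).
have Dlip x y : `|D x - D y| <= 2 * `|x - y|.
  have l1 := lipschitz b0 (lexx 1) c1P x y.
  have l2 := lipschitz (lexx 0) b1 c2P x y.
  rewrite /D (_ : _ - _ = (H x (c1 x) - H y (c1 y)) - (H x (c2 x) - H y (c2 y))); last by ring.
  by rewrite (le_trans (ler_normB _ _))// mulr_natl mulr2n lerD.
have cD : continuous D.
  move=> x; apply/cvgrPdist_lt => e e0; near=> y.
  rewrite (le_lt_trans (Dlip x y))// mulrC -ltr_pdivlMr//.
  near: y; apply: (@cvgr_dist_lt _ _ _ (nbhs x) _ id) => //; rewrite ?divr_gt0//.
have L1b u : u \in `[b, 1] -> L u <= v.
  rewrite in_itv/= => /andP[bu u1]; rewrite -Lb Lni// in_itv/=.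
  by rewrite (le_trans b0 bu).
have L2b u : u \in `[0, b] -> v <= L u.
  rewrite in_itv/= => /andP[u0 ub]; rewrite -Lb Lni// in_itv/=.
  by rewrite u0 (le_trans ub b1).
have oneI : (1 : R) \in `[b, 1] by rewrite in_itv/= lexx b1.
have zeroI : (0 : R) \in `[0, b] by rewrite in_itv/= lexx b0.
have Kge0 u : u \in `[0, 1] -> 0 <= K u.
  rewrite in_itv/= => /andP[u0]; rewrite le_eqVlt => /predU1P[->|u1]; first by rewrite K1.
  by apply/ltW/Kgt0; rewrite in_itv/= u0.
have sub1 u : u \in `[b, 1] -> u \in `[0, 1].
  by rewrite !in_itv/= => /andP[h1 ->]; rewrite (le_trans b0 h1).
have sub2 u : u \in `[0, b] -> u \in `[0, 1].
  by rewrite !in_itv/= => /andP[-> h1]; rewrite (le_trans h1 b1).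
(* at the slope [M] the right endpoint wins: [- M * v = 1 - M] *)
pose M := (1 - v)^-1; have M0 : 0 < M by rewrite invr_gt0 subr_gt0.
have D0 : D 0 <= 0.
  have [_ /(_ _ oneI)] := c1P 0; have [/sub2/Kge0 h _] := c2P 0.
  by rewrite /D /H K1 !mul0r !subr0; lra.
have DM : 0 <= D M.
  have [/L1b l1 _] := c1P M; have [_ /(_ _ zeroI)] := c2P M.
  have [/sub1/Kge0 h _] := c1P M.
  rewrite /D /H K0 L0 mulr1 => h2.
  have : M * L (c1 M) <= M * v by rewrite ler_pM2l.
  have : M * (1 - v) = 1 by rewrite mulVf// subr_eq0 gt_eqF.
  rewrite mulrBr mulr1; lra.
have [lam lamM Dlam] : exists2 lam, lam \in `[0, M] & D lam = 0.
  apply: IVT; [exact: ltW|exact: continuous_subspaceT|].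
  by rewrite min_l ?max_r// ?D0 ?DM// (le_trans D0).
have HE : H lam (c1 lam) = H lam (c2 lam) by apply/eqP; rewrite -subr_eq0 -/(D lam) Dlam.
have [i1 m1] := c1P lam; have [i2 m2] := c2P lam.
exists lam, (H lam (c1 lam)), (c1 lam), (c2 lam); split => //.
- move: lamM; rewrite in_itv/= le_eqVlt => /andP[/predU1P[lE|//] _].
  have /Kgt0 : c2 lam \in `[0, 1[.
    move: i2; rewrite !in_itv/= => /andP[-> h]; rewrite (le_lt_trans h)//.
    by rewrite lt_neqAle b1 andbT; apply/eqP => bE; move: v0; rewrite -Lb bE L1 ltxx.
  have := m1 _ oneI; rewrite HE /H K1 -lE !mul0r !subr0; lra.
- move=> u; rewrite in_itv/= => /andP[u0 u1]; have [ub|bu] := leP u b.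
    by rewrite HE; apply: m2; rewrite in_itv/= u0.
  by apply: m1; rewrite in_itv/= u1 ltW.
- by split; [exact: sub1|by []|exact: L1b].
- by split; [exact: sub2|by rewrite HE|exact: L2b].
Unshelve. all: by end_near. Qed.

End lower_hull.

Section contact.
Context {d} {T : measurableType d} {R : realType} {P : probability T R}.
Variables (phi : {RV P >-> R}) (k : R -> R).
Hypothesis phi_gt0 : {ae P, forall w, 0 < phi w}.
Hypothesis phi_mean : ('E_P[phi] = 1)%E.
Hypothesis wk : weight k.
Local Notation F := (dfun phi).
Local Notation Fl := (dfunl phi).
Local Notation q := (quantile phi).

(** The point of parameter [u] of the curve lies on the supporting line. *)
Definition contact (lam m u : R) := tail k u - lam * tail q u = m.

Lemma level_set0 : level phi set0 = 1.
Proof. by rewrite /level setC0 preimage_setT probability_setT. Qed.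

(** Contact points can be moved to levels of upper sets, in either direction.  The
    parameters which are not such levels are interior to flat pieces of the
    quantile function, and there the whole piece is in contact. *)
Lemma contact_upper (lam m u : R) :
  {in `[0, 1], forall u, m <= tail k u - lam * tail q u} ->
  u \in `[0, 1] -> contact lam m u ->
  (exists U, [/\ upper_set U, U `<=` `]0, +oo[, contact lam m (level phi U) &
               u <= level phi U]) /\
  (exists U, [/\ upper_set U, U `<=` `]0, +oo[, contact lam m (level phi U) &
               level phi U <= u]).
Proof.
move=> mmin; have wq := quantile_weight phi_gt0 phi_mean.
rewrite in_itv/= => /andP[]; rewrite le_eqVlt => /predU1P[<- _ c0|u0].
  have lev0 : level phi `]0, +oo[ = 0 by rewrite level_oy (dfun_le0 phi_gt0).
  by split; exists `]0, +oo[%classic; rewrite lev0; split => //; exact: upper_set_oy.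
rewrite le_eqVlt => /predU1P[->|u1] cu.
  by split; exists set0; rewrite level_set0; split => //; move=> x y.
have u01 : u \in `]0, 1[ by rewrite in_itv/= u0.
have /andP[Flu uF] := dfunl_quantile phi u01.
have q0 := quantile_gt0 phi_gt0 u01.
have flat : {in `](Fl (q u)), (F (q u))[, forall t, q t = q u}.
  move=> t; rewrite in_itv/= => /andP[h1 h2]; apply: quantile_between; rewrite ?h1//.
  by rewrite in_itv/= (le_lt_trans (dfunl_ge0 _ _) h1) (lt_le_trans h2)// dfun_le1.
have uI : u \in `[(Fl (q u)), (F (q u))] by rewrite in_itv/= Flu.
have [LFl LF] := tail_affine wq (dfunl_ge0 _ _) (dfun_le1 _ _) flat uI.
have Fl01 : Fl (q u) \in `[0, 1].
  by rewrite in_itv/= dfunl_ge0 (le_trans Flu)// ltW.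
have F01 : F (q u) \in `[0, 1].
  by rewrite in_itv/= dfun_le1 (le_trans _ uF)// ltW.
have KFl := tail_supergradient wk u01 Fl01.
have KF := tail_supergradient wk u01 F01.
have mFl := mmin _ Fl01; have mF := mmin _ F01.
have U1 : upper_set `](q u), +oo[ /\ `](q u), +oo[ `<=` (`]0, +oo[ : set R).
  split; first exact: upper_set_oy.
  by move=> x /=; rewrite !in_itv/= !andbT; exact: lt_trans.
have U2 : upper_set `[(q u), +oo[ /\ `[(q u), +oo[ `<=` (`]0, +oo[ : set R).
  split; first exact: upper_set_cy.
  by move=> x /=; rewrite !in_itv/= !andbT; exact: lt_le_trans.
have [uE|uFl] := eqVneq (Fl (q u)) u.
  by case: U2 => ? ?; split; exists `[(q u), +oo[%classic; split; rewrite // -/(Fl _) uE.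
have [uE|uF'] := eqVneq (F (q u)) u.
  by case: U1 => ? ?; split; exists `](q u), +oo[%classic; split; rewrite // level_oy uE.
have A0 : 0 < u - Fl (q u) by rewrite subr_gt0 lt_neqAle uFl.
have B0 : 0 < F (q u) - u by rewrite subr_gt0 lt_neqAle eq_sym uF'.
(* [u] is interior to a flat piece, along which [tail q] is affine and
   [tail k] is concave; a minimum there forces the slope to vanish *)
have s0 : k u - lam * q u = 0.
  apply/eqP; rewrite eq_le; apply/andP; split.
    rewrite -(pmulr_lle0 _ B0); move: mF cu; rewrite /contact LF; nra.
  rewrite -(pmulr_lge0 _ A0); move: mFl cu; rewrite /contact LFl; nra.
split.
  exists `](q u), +oo[%classic; case: U1 => ? ?; rewrite level_oy; split => //.
  apply/eqP; rewrite eq_le mF andbT -cu LF -subr_ge0.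
  move: KF; rewrite (_ : k u = lam * q u); last by apply/eqP; rewrite -subr_eq0 s0.
  by lra.
exists `[(q u), +oo[%classic; case: U2 => ? ?; split => //.
apply/eqP; rewrite eq_le mFl andbT -cu LFl -subr_ge0.
move: KFl; rewrite (_ : k u = lam * q u); last by apply/eqP; rewrite -subr_eq0 s0.
by lra.
Qed.

End contact.

Lemma eq_integral_ae_set d (T : measurableType d) (R : realType)
    (m : {measure set T -> \bar R}) (A B : set T) (f : T -> \bar R) :
  measurable A -> measurable B -> measurable_fun setT f ->
  {ae m, forall w, A w <-> B w} ->
  (\int[m]_(w in A) f w = \int[m]_(w in B) f w)%E.
Proof.
move=> mA mB mf AB; rewrite integral_mkcond [RHS]integral_mkcond.
apply: ae_eq_integral => //.
- by apply/(measurable_restrictT _ mA); exact: measurable_funS mf.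
- by apply/(measurable_restrictT _ mB); exact: measurable_funS mf.
apply: filterS AB => w AB _; rewrite !patchE.
by have -> : (w \in A) = (w \in B) by apply/idP/idP; rewrite !inE => /AB.
Qed.

(** * Both problems in terms of levels *)

Section tail_representation.
Context {d} {T : measurableType d} {R : realType} {P : probability T R}.
Local Notation mu := (@lebesgue_measure R).

Lemma measurable_level_gt (Y : {RV P >-> R}) s : measurable [set w | s < Y w].
Proof.
rewrite (_ : [set w | _] = Y @^-1` `]s, +oo[); first exact: measurable_funPTI.
by apply/seteqP; split => w; rewrite /= in_itv/= andbT.
Qed.

Lemma weighted_layer_cake (W : T -> R) (Y : {RV P >-> R}) :
  measurable_fun setT W -> (forall w, 0 <= W w) ->
  {ae P, forall w, 0 <= Y w <= 1} ->
  (\int[P]_w (W w * Y w)%:E =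
   \int[mu]_(s in `]0%R, 1%R[) \int[P]_(w in [set w | (s < Y w)%R]) (W w)%:E)%E.
Proof.
move=> mW W0 Y01.
pose D := [set w | 0 <= Y w <= 1].
have mD : measurable D.
  rewrite (_ : D = Y @^-1` `[0, 1]); first exact: measurable_funPTI.
  by apply/seteqP; split => w; rewrite /D/= in_itv.
transitivity (\int[P]_(w in D) (W w * Num.max (Y w - (fun=> 0) w) 0)%:E)%E.
  rewrite [RHS]integral_mkcond; apply: ae_eq_integral => //.
  - by apply/measurable_EFinP; apply: measurable_funM.
  - apply/(measurable_restrictT _ mD)/measurable_EFinP.
    apply: measurable_funTS; apply: measurable_funM => //.
    apply: measurable_maxr; last exact: measurable_cst.
    by apply: measurable_funB => //; exact: measurable_cst.
  apply: filterS Y01 => w Y01 _; rewrite patchE mem_set//=.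
  by rewrite subr0 max_l//; case/andP: Y01.
rewrite layer_cake//.
- apply: eq_integral => s; rewrite inE/= in_itv/= => /andP[s0 s1].
  apply: eq_integral_ae_set.
  + apply: measurableI => //.
    rewrite (_ : [set x | _] = [set w | s < Y w]); first exact: measurable_level_gt.
    by apply/seteqP; split => w; rewrite /= s0.
  + exact: measurable_level_gt.
  + exact/measurable_EFinP.
  + by apply: filterS Y01 => w Y01; rewrite /D/= s0; split => [[]|].
- exact: measurable_funTS.
- exact: measurable_funTS.
- by move=> w /andP[].
Qed.

Lemma dfunE_gt (Y : {RV P >-> R}) s : dfun Y s = fine (P (~` [set w | s < Y w])).
Proof.
rewrite /dfun /cdf /distribution/= /pushforward; congr (fine (P _)).
by apply/seteqP; split => w; rewrite /= in_itv/= leNgt => /negP.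
Qed.

Lemma quantile_01 (Y : {RV P >-> R}) t : {ae P, forall w, 0 <= Y w <= 1} ->
  t \in `]0, 1[ -> 0 <= quantile Y t <= 1.
Proof.
move=> Y01 t01; have /andP[t0 t1] : 0 < t < 1 by rewrite in_itv/= in t01.
apply/andP; split; last first.
  rewrite quantileP// (le_trans (ltW t1))// -lee_fin -dfunE.
  have [N [mN N0 sN]] := Y01.
  have <- : P (~` N) = 1%E by rewrite probability_setC// N0 sube0.
  apply: le_measure; rewrite ?inE//; first exact: measurableC.
    exact: measurable_funPTI.
  move=> w nN /=; rewrite in_itv/=; apply: contrapT => Yw.
  by apply: nN; apply: sN => /= /andP[_].
rewrite leNgt; apply/negP => q0.
have := lexx (quantile Y t); rewrite {1}quantileP//.
suff -> : dfun Y (quantile Y t) = 0 by rewrite leNgt t0.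
have [N [mN N0 sN]] := Y01.
apply/eqP; rewrite eq_le dfun_ge0 andbT -lee_fin -dfunE (_ : 0%:E = P N)//.
rewrite /cdf /distribution/= /pushforward.
apply: le_measure; rewrite ?inE//; first exact: measurable_funPTI.
move=> w /=; rewrite in_itv/= => Yq; apply: sN => /= /andP[Y0 _].
by have := le_lt_trans (le_trans Y0 Yq) q0; rewrite ltxx.
Qed.

(** The layer-cake formula on the unit interval with weight [k]: the quantile
    function of [Y] exceeds [s] exactly above [P[Y <= s]]. *)
Lemma rho_neg_tail (k : R -> R) (Y : {RV P >-> R}) : weight k ->
  {ae P, forall w, 0 <= Y w <= 1} ->
  (rho_neg k Y = \int[mu]_(s in `]0%R, 1%R[) (tail k (dfun Y s))%:E)%E.
Proof.
move=> wk Y01; have [k0 _ _] := wk.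
transitivity (\int[mu]_(t in `]0%R, 1%R[)
    (k t * Num.max (quantile Y t - (fun=> 0) t) 0)%:E)%E.
  apply: eq_integral => t; rewrite inE/= => t01.
  by rewrite subr0 max_l//; case/andP: (quantile_01 Y01 t01).
rewrite layer_cake//.
- apply: eq_integral => s; rewrite inE/= => s01.
  have s0 : 0 < s by move: s01; rewrite in_itv => /andP[].
  rewrite -(tailE wk) ?dfun_ge0//; congr (integral _ _ _).
  apply/seteqP; split => t /=.
    move=> [t01 /andP[_ sq]]; move: (t01); rewrite !in_itv/= => /andP[_ ->].
    by rewrite andbT ltNge -quantileP// -ltNge.
  rewrite in_itv/= => /andP[Ft t1].
  have t01 : t \in `]0, 1[ by rewrite in_itv/= t1 (le_lt_trans (dfun_ge0 Y s)).
  by split => //; rewrite s0 ltNge quantileP// -ltNge.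
- exact: weight_measurable.
- exact: quantile_measurable.
- by move=> t t01; case/andP: (quantile_01 Y01 t01).
Qed.

Section increasing_profile.
Variables (phi : {RV P >-> R}) (k : R -> R).
Hypothesis phi_gt0 : {ae P, forall w, 0 < phi w}.
Hypothesis phi_mean : ('E_P[phi] = 1)%E.
Hypothesis wk : weight k.
Local Notation g := (g_of k phi).
Local Notation q := (quantile phi).

Lemma restrict_measurable f : increasing01 f -> measurable_fun setT (f \_ (`]0, +oo[ : set R)).
Proof.
move=> [fnd _]; have m0 : measurable (`]0, +oo[ : set R) by [].
apply/(measurable_restrictT _ m0).
apply: measurable_fun_homo_in; first exact: interval_is_interval.
by move=> x y; rewrite !inE/=; exact: fnd.
Qed.

Lemma comp_pos_measurable f : increasing01 f -> measurable_fun setT (comp_pos f phi).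
Proof.
by move=> incf; rewrite /comp_pos; apply: measurableT_comp => //; exact: restrict_measurable.
Qed.

Definition RV_of (X : T -> R) (mX : measurable_fun setT X) : {RV P >-> R} :=
  HB.pack_for {mfun T >-> R} X (isMeasurableFun.Build _ _ _ _ X mX).

Lemma comp_posE f w : 0 < phi w -> comp_pos f phi w = f (phi w).
Proof. by move=> p0; rewrite /comp_pos/= patchE mem_set//= in_itv/= p0. Qed.

Lemma comp_pos_01 f w : increasing01 f -> 0 <= comp_pos f phi w <= 1.
Proof.
move=> [_ f01]; rewrite /comp_pos/= patchE; case: ifPn => [/set_mem|_].
  exact: f01.
by rewrite lexx ler01.
Qed.

Definition superlevel (f : R -> R) (s : R) : set R := [set x | 0 < x /\ s < f x].

Lemma superlevel_upper f s : increasing01 f -> upper_set (superlevel f s).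
Proof.
move=> [fnd _] x y [x0 sf] xy; have y0 : 0 < y := lt_le_trans x0 xy.
by split => //; apply: (lt_le_trans sf); apply: fnd; rewrite // in_itv/= andbT.
Qed.

Lemma comp_pos_gt f s : 0 <= s ->
  [set w | s < comp_pos f phi w] = phi @^-1` (superlevel f s).
Proof.
move=> s0; apply/seteqP; split => w /=; rewrite /superlevel/=.
  rewrite {1}/comp_pos/= patchE; case: ifPn => [/set_mem /=|_].
    by rewrite in_itv/= andbT.
  by rewrite /= ltNge s0.
by move=> [p0 sf]; rewrite comp_posE.
Qed.

Lemma dfun_comp_pos f s (Y : {RV P >-> R}) : Y = comp_pos f phi :> (T -> R) ->
  0 <= s -> dfun Y s = level phi (superlevel f s).
Proof. by move=> YE s0; rewrite dfunE_gt YE comp_pos_gt. Qed.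

Let gpos w : R := Num.max (g (phi w)) 0.

Let gpos_measurable : measurable_fun setT gpos.
Proof.
apply: measurable_maxr; last exact: measurable_cst.
by apply: measurableT_comp => //; exact: g_of_measurable.
Qed.

Let ae_gpos : {ae P, forall w, gpos w = g (phi w)}.
Proof. by apply: filterS (ae_bulk phi) => w /(g_of_ge0 wk) g0; exact: max_l. Qed.

Let V_objectiveE f : increasing01 f ->
  V_objective k phi f = (\int[P]_w (gpos w * comp_pos f phi w)%:E)%E.
Proof.
move=> incf; rewrite /V_objective unlock; apply: ae_eq_integral => //.
- apply/measurable_EFinP; apply: measurable_funM; last exact: comp_pos_measurable.
  by apply: measurableT_comp => //; exact: g_of_measurable.
- apply/measurable_EFinP; apply: measurable_funM => //; exact: comp_pos_measurable.
- by apply: filterS ae_gpos => w ->.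
Qed.

Let integral_gpos_upper U : upper_set U ->
  (\int[P]_(w in phi @^-1` U) (gpos w)%:E = (tail k (level phi U))%:E)%E.
Proof.
move=> uU; rewrite -(expectation_g_of_upper phi wk uU).
have mU := measurable_funPTI phi (upper_set_measurable uU).
apply: ae_eq_integral => //.
- by apply/measurable_EFinP; exact: measurable_funTS.
- apply/measurable_EFinP; apply: measurable_funTS.
  by apply: measurableT_comp => //; exact: g_of_measurable.
- by apply: filterS ae_gpos => w -> _.
Qed.

(** Both sides are mixtures over [s] of their values at the indicators of the
    sets [f > s], which are upper sets. *)
Lemma V_objective_rho f (Y : {RV P >-> R}) : increasing01 f ->
  Y = comp_pos f phi :> (T -> R) -> V_objective k phi f = rho_neg k Y.
Proof.
move=> incf YE; rewrite V_objectiveE//.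
have Y01 : {ae P, forall w, 0 <= Y w <= 1}.
  by apply: aeW => w; rewrite YE; exact: comp_pos_01.
rewrite rho_neg_tail// -YE weighted_layer_cake//; last first.
  by move=> w; rewrite /gpos le_max lexx orbT.
apply: eq_integral => s; rewrite inE/= in_itv/= => /andP[/ltW s0 _].
rewrite YE comp_pos_gt// integral_gpos_upper ?(dfun_comp_pos YE)//.
exact: superlevel_upper.
Qed.

(** For [U1] contained in [U2] this is [1] on [U1], [theta] on the rest of [U2],
    and [0] elsewhere; the mixture form makes price and objective linear in
    [theta]. *)
Definition two_step (theta : R) (U1 U2 : set R) (x : R) : R :=
  (1 - theta) * \1_U1 x + theta * \1_U2 x.

Section two_step.
Variables (theta : R) (U1 U2 : set R).
Hypotheses (theta01 : 0 <= theta <= 1) (uU1 : upper_set U1) (uU2 : upper_set U2).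
Hypotheses (U1p : U1 `<=` `]0, +oo[) (U2p : U2 `<=` `]0, +oo[).

Let indic_le (U : set R) x y : upper_set U -> x <= y -> \1_U x <= \1_U y :> R.
Proof.
move=> uU xy; rewrite !indicE; have [/set_mem Ux|_] := boolP (x \in U).
  by rewrite mem_set//; exact: uU xy.
by rewrite ler0n.
Qed.

Lemma two_step_increasing : increasing01 (two_step theta U1 U2).
Proof.
have /andP[h0 h1] := theta01.
split=> [x y _ _ xy|x _].
  by rewrite lerD// ler_wpM2l ?subr_ge0//; exact: indic_le.
rewrite /two_step !indicE.
by case: (x \in U1); case: (x \in U2); rewrite ?mulr1 ?mulr0; lra.
Qed.

Lemma integral_two_step (W : T -> R) : measurable_fun setT W -> (forall w, 0 <= W w) ->
  (\int[P]_w (W w * comp_pos (two_step theta U1 U2) phi w)%:E =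
   (1 - theta)%:E * \int[P]_(w in phi @^-1` U1) (W w)%:E +
   theta%:E * \int[P]_(w in phi @^-1` U2) (W w)%:E)%E.
Proof.
move=> mW W0; have /andP[h0 h1] := theta01.
have restr U : upper_set U ->
    (\int[P]_(w in phi @^-1` U) (W w)%:E = \int[P]_w (W w * \1_U (phi w))%:E)%E.
  move=> uU; rewrite integral_mkcond; apply: eq_integral => w _.
  rewrite patchE indicE.
  have -> : (w \in phi @^-1` U) = (phi w \in U) by apply/idP/idP; rewrite !inE.
  by case: ifPn; rewrite ?mulr1 ?mulr0.
have mWU U : upper_set U -> measurable_fun setT (fun w => (W w * \1_U (phi w))%:E).
  move=> uU; apply/measurable_EFinP; apply: measurable_funM => //.
  apply: measurableT_comp => //; apply: measurable_indic.
  exact: upper_set_measurable.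
have WU0 U w : (0 <= (W w * \1_U (phi w))%:E)%E by rewrite lee_fin mulr_ge0.
rewrite !restr// -!ge0_integralZl_EFin ?subr_ge0//; [|exact: mWU..].
rewrite -ge0_integralD//; last 4 first.
- by move=> w _; rewrite mule_ge0// lee_fin subr_ge0.
- by apply: measurable_funeM; exact: mWU.
- by move=> w _; rewrite mule_ge0.
- by apply: measurable_funeM; exact: mWU.
apply: eq_integral => w _; rewrite -!EFinM -EFinD; congr EFin.
have -> : comp_pos (two_step theta U1 U2) phi w = two_step theta U1 U2 (phi w).
  rewrite /comp_pos/= patchE; case: ifPn => // np.
  rewrite /two_step !indicE !memNset ?mulr0 ?addr0//.
    by move=> /U2p h; move: np; rewrite mem_set.
  by move=> /U1p h; move: np; rewrite mem_set.
by rewrite /two_step; ring.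
Qed.

Lemma V_objective_two_step : V_objective k phi (two_step theta U1 U2) =
  ((1 - theta) * tail k (level phi U1) + theta * tail k (level phi U2))%:E.
Proof.
rewrite V_objectiveE; last exact: two_step_increasing.
rewrite integral_two_step ?integral_gpos_upper//.
by move=> w; rewrite /gpos le_max lexx orbT.
Qed.

End two_step.

Lemma expectation_pos_part (X : T -> R) : measurable_fun setT X ->
  ('E_P[fun w => (phi w * X w)%R] = \int[P]_w (pos_part phi w * X w)%:E)%E.
Proof.
move=> mX; rewrite unlock; apply: ae_eq_integral => //.
- by apply/measurable_EFinP; exact: measurable_funM.
- by apply/measurable_EFinP; apply: measurable_funM => //; exact: pos_part_measurable.
- by apply: filterS (ae_pos_part phi_gt0) => w ->.
Qed.

Lemma expectation_two_step theta (U1 U2 : set R) : 0 <= theta <= 1 ->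
  upper_set U1 -> upper_set U2 -> U1 `<=` `]0, +oo[ -> U2 `<=` `]0, +oo[ ->
  ('E_P[fun w => (phi w * comp_pos (two_step theta U1 U2) phi w)%R] =
   ((1 - theta) * tail q (level phi U1) + theta * tail q (level phi U2))%:E)%E.
Proof.
move=> h uU1 uU2 U1p U2p; rewrite expectation_pos_part; last first.
  by apply: comp_pos_measurable; exact: two_step_increasing.
rewrite integral_two_step ?(integral_pos_part_upper phi_gt0 phi_mean)//.
- exact: pos_part_measurable.
- exact: pos_part_ge0.
Qed.

End increasing_profile.
End tail_representation.

(** * The Lagrangian bound *)

Lemma ae_imp d (T : measurableType d) (R : realType)
    (m : {measure set T -> \bar R}) (A B : T -> Prop) :
  (forall x, A x -> B x) -> {ae m, forall x, A x} -> {ae m, forall x, B x}.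
Proof. by move=> AB; apply: filterS. Qed.

Lemma ae_eq0_of_Rintegral d (T : measurableType d) (R : realType)
    (m : {measure set T -> \bar R}) (D : set T) (h : T -> R) : measurable D ->
  m.-integrable D (EFin \o h) -> {ae m, forall x, D x -> 0 <= h x} ->
  \int[m]_(x in D) h x = 0 -> {ae m, forall x, D x -> h x = 0}.
Proof.
move=> mD ih h0 int0; have mh : measurable_fun D (EFin \o h) by exact: measurable_int ih.
have H : (\int[m]_(x in D) `|(EFin \o h) x| = 0)%E.
  have <- : (\int[m]_(x in D) (EFin \o h) x = 0)%E.
    by rewrite -[LHS]fineK ?integrable_fin_num// -[0%E]/(0%:E) -int0.
  apply: ae_eq_integral => //; first exact: measurableT_comp.
  by apply: filterS h0 => x h0 Dx /=; rewrite ger0_norm// h0.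
have {}H := (ae_eq_integral_abs m mD mh).1 H.
by apply: filterS H => x + Dx => /(_ Dx) /= [].
Qed.

Lemma ae_eq_of_Rintegral d (T : measurableType d) (R : realType)
    (m : {measure set T -> \bar R}) (D : set T) (f1 f2 : T -> R) : measurable D ->
  m.-integrable D (EFin \o f1) -> m.-integrable D (EFin \o f2) ->
  {ae m, forall x, D x -> f1 x <= f2 x} ->
  \int[m]_(x in D) f1 x = \int[m]_(x in D) f2 x ->
  {ae m, forall x, D x -> f1 x = f2 x}.
Proof.
move=> mD i1 i2 f12 int12.
have ii : m.-integrable D (EFin \o (fun x => f2 x - f1 x)).
  rewrite (_ : _ \o _ = ((EFin \o f2) \- (EFin \o f1))%E); last by apply/funext.
  exact: (integrableB _ i2 i1).
have ge0 : {ae m, forall x, D x -> 0 <= f2 x - f1 x}.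
  by apply: ae_imp f12 => x + Dx => /(_ Dx); rewrite subr_ge0.
have int0 : \int[m]_(x in D) (f2 x - f1 x) = 0 by rewrite RintegralB// int12 subrr.
apply: ae_imp (ae_eq0_of_Rintegral mD ii ge0 int0) => x + Dx => /(_ Dx) /eqP.
by rewrite subr_eq0 => /eqP.
Qed.

Section lagrangian.
Context {d} {T : measurableType d} {R : realType} {P : probability T R}.
Variables (phi : {RV P >-> R}) (k : R -> R).
Hypothesis phi_gt0 : {ae P, forall w, 0 < phi w}.
Hypothesis phi_mean : ('E_P[phi] = 1)%E.
Hypothesis wk : weight k.
Local Notation mu := (@lebesgue_measure R).
Local Notation q := (quantile phi).

(** The price of the event [Y > s]. *)
Definition price_gt (Y : {RV P >-> R}) (s : R) : R :=
  fine (\int[P]_(w in [set w | (s < Y w)%R]) (pos_part phi w)%:E).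

Lemma price_gtE (Y : {RV P >-> R}) s :
  (\int[P]_(w in [set w | (s < Y w)%R]) (pos_part phi w)%:E = (price_gt Y s)%:E)%E.
Proof.
rewrite /price_gt fineK// ge0_fin_numE; last first.
  by apply: integral_ge0 => w _; rewrite lee_fin pos_part_ge0.
apply: (le_lt_trans (np_le phi_gt0 phi_mean (measurable_level_gt Y s))).
exact: ltry.
Qed.

Lemma price_gt_ge0 (Y : {RV P >-> R}) s : 0 <= price_gt Y s.
Proof.
by apply: fine_ge0; apply: integral_ge0 => w _; rewrite lee_fin pos_part_ge0.
Qed.

Lemma price_gt_le (Y : {RV P >-> R}) s : price_gt Y s <= tail q (dfun Y s).
Proof.
rewrite -lee_fin -price_gtE dfunE_gt.
exact: np_le (measurable_level_gt Y s).
Qed.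

Lemma price_gt_nonincreasing (Y : {RV P >-> R}) :
  {homo price_gt Y : s t /~ s <= t}.
Proof.
move=> s t ts; rewrite -lee_fin -!price_gtE; apply: ge0_subset_integral.
- exact: measurable_level_gt.
- exact: measurable_level_gt.
- by apply/measurable_EFinP/measurable_funTS; exact: pos_part_measurable.
- by move=> w _; rewrite lee_fin pos_part_ge0.
- by move=> w /=; exact: le_lt_trans.
Qed.

Lemma Rintegral_cst01 (c : R) : \int[mu]_(s in `]0, 1[) cst c s = c.
Proof. by rewrite Rintegral_cst//= lebesgue_measure_itv/= lte01 -EFinB/= subr0 mulr1. Qed.

Lemma cst01_integrable (c : R) : mu.-integrable (`]0, 1[ : set R) (EFin \o cst c).
Proof.
apply: measurable_bounded_integrable => //=.
- by rewrite lebesgue_measure_itv/= lte01 -EFinB ltry.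
- exists `|c|; split; first exact: num_real.
  by move=> y cy s _ /=; exact: ltW.
Qed.

Lemma integrable_bounded01 (h : R -> R) : {homo h : s t /~ s <= t} ->
  (forall s, 0 <= h s <= 1) -> mu.-integrable (`]0, 1[ : set R) (EFin \o h).
Proof.
move=> hni h01; apply: measurable_bounded_integrable => //=.
- by rewrite lebesgue_measure_itv/= lte01 -EFinB ltry.
- by apply: nonincreasing_measurable => // s t st; exact: hni.
- exists 1; split; first exact: num_real.
  move=> y y1 s _ /=; have /andP[h0 h1] := h01 s.
  by rewrite ger0_norm// (le_trans h1)// ltW.
Qed.

Lemma tail_dfun_integrable (w : R -> R) (Y : {RV P >-> R}) : weight w ->
  mu.-integrable (`]0, 1[ : set R) (EFin \o (fun s => tail w (dfun Y s))).
Proof.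
move=> ww; apply: integrable_bounded01 => [s t ts|s].
  by apply: tail_nonincreasing; rewrite ?dfun_ge0 ?dfun_le1// dfun_nondecreasing.
by rewrite tail_ge0 ?tail_le1 ?dfun_ge0 ?dfun_le1.
Qed.

Lemma price_gt_integrable (Y : {RV P >-> R}) :
  mu.-integrable (`]0, 1[ : set R) (EFin \o price_gt Y).
Proof.
apply: integrable_bounded01; first exact: price_gt_nonincreasing.
move=> s; rewrite price_gt_ge0 (le_trans (price_gt_le Y s))//.
by apply: (tail_le1 (quantile_weight phi_gt0 phi_mean)); rewrite ?dfun_ge0 ?dfun_le1.
Qed.

Lemma rho_negE (Y : {RV P >-> R}) : {ae P, forall w, 0 <= Y w <= 1} ->
  rho_neg k Y = (\int[mu]_(s in `]0, 1[) tail k (dfun Y s))%:E.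
Proof.
move=> Y01; rewrite rho_neg_tail// /Rintegral fineK//.
by apply: integrable_fin_num => //; exact: tail_dfun_integrable.
Qed.

Lemma expectation_price (Y : {RV P >-> R}) : {ae P, forall w, 0 <= Y w <= 1} ->
  ('E_P[fun w => (phi w * Y w)%R] = (\int[mu]_(s in `]0, 1[) price_gt Y s)%R%:E)%E.
Proof.
move=> Y01; rewrite expectation_pos_part// weighted_layer_cake//; last 2 first.
- exact: pos_part_measurable.
- exact: pos_part_ge0.
under eq_integral do rewrite price_gtE.
rewrite /Rintegral fineK//.
by apply: integrable_fin_num => //; exact: price_gt_integrable.
Qed.

Variables lam m : R.
Hypothesis lam_gt0 : 0 < lam.
Hypothesis mmin : {in `[0, 1], forall u, m <= tail k u - lam * tail q u}.

Let tail_ge (Y : {RV P >-> R}) s :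
  m <= tail k (dfun Y s) - lam * tail q (dfun Y s).
Proof. by apply: mmin; rewrite in_itv/= dfun_ge0 dfun_le1. Qed.

Let price_le (Y : {RV P >-> R}) s : lam * price_gt Y s <= lam * tail q (dfun Y s).
Proof. by rewrite ler_pM2l// price_gt_le. Qed.

Let bound_le (Y : {RV P >-> R}) s : lam * price_gt Y s + m <= tail k (dfun Y s).
Proof. by have := tail_ge Y s; have := price_le Y s; lra. Qed.

Let lamprice_integrable (Y : {RV P >-> R}) :
  mu.-integrable (`]0, 1[ : set R) (EFin \o (fun s => lam * price_gt Y s)).
Proof.
rewrite (_ : _ \o _ = (fun s => lam%:E * (EFin \o price_gt Y) s)%E); last first.
  by apply/funext => s /=; rewrite EFinM.
by apply: integrableZl => //; exact: price_gt_integrable.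
Qed.

Let bound_integrable (Y : {RV P >-> R}) :
  mu.-integrable (`]0, 1[ : set R) (EFin \o (fun s => lam * price_gt Y s + m)).
Proof.
rewrite (_ : _ \o _ = ((EFin \o (fun s : R => (lam * price_gt Y s)%R)) \+
  (EFin \o cst m))%E); last by apply/funext.
exact: (integrableD _ (lamprice_integrable Y) (cst01_integrable m)).
Qed.

Let integral_bound (Y : {RV P >-> R}) :
  \int[mu]_(s in `]0, 1[) (lam * price_gt Y s + m) =
  lam * \int[mu]_(s in `]0, 1[) price_gt Y s + m.
Proof.
rewrite (@RintegralD _ _ _ mu _ (fun s => lam * price_gt Y s) (cst m))//; last first.
  exact: cst01_integrable.
by rewrite RintegralZl ?Rintegral_cst01//; exact: price_gt_integrable.
Qed.

(** Weak duality: mix over [s] the supporting line at the point of parameter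
    [P[Y <= s]], after the Neyman-Pearson bound for the price of [Y > s]. *)
Lemma lagrangian_le (Y : {RV P >-> R}) :
  lam * \int[mu]_(s in `]0, 1[) price_gt Y s + m <=
  \int[mu]_(s in `]0, 1[) tail k (dfun Y s).
Proof.
rewrite -integral_bound; apply: le_Rintegral => //; exact: tail_dfun_integrable.
Qed.

(** No loss is allowed at almost every level: neither in the supporting line nor
    in the Neyman-Pearson bound, the latter because the slope is positive. *)
Lemma lagrangian_eq (Y : {RV P >-> R}) :
  \int[mu]_(s in `]0, 1[) tail k (dfun Y s) =
    lam * \int[mu]_(s in `]0, 1[) price_gt Y s + m ->
  {ae mu, forall s, s \in `]0, 1[ ->
    contact phi k lam m (dfun Y s) /\ price_gt Y s = tail q (dfun Y s)}.
Proof.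
rewrite -integral_bound => /esym YE.
have le12 : {ae mu, forall s, (`]0, 1[%classic : set R) s ->
    lam * price_gt Y s + m <= tail k (dfun Y s)} by apply: aeW.
have := ae_eq_of_Rintegral (m := mu) _ (bound_integrable Y)
  (tail_dfun_integrable Y wk) le12 YE.
move=> /(_ (measurable_itv _)); apply: ae_imp => s + s01 => /(_ s01) sE.
have t := tail_ge Y s; have h := price_le Y s.
have e : lam * price_gt Y s = lam * tail q (dfun Y s) by lra.
split; first by rewrite /contact -e; lra.
by apply: (mulfI (lt0r_neq0 lam_gt0)).
Qed.

End lagrangian.

(** * Comparing claims through their levels *)

Section levels.
Context {d} {T : measurableType d} {R : realType} {P : probability T R}.
Local Notation mu := (@lebesgue_measure R).

(** The mean of the positive part of [X - Y] is the mean over [s] of the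
    probability of [Y < s < X]. *)
Lemma ae_le_of_levels (X Y : {RV P >-> R}) :
  {ae P, forall w, 0 <= X w <= 1} -> {ae P, forall w, 0 <= Y w <= 1} ->
  {ae mu, forall s, s \in `]0, 1[ -> P.-negligible [set w | Y w < s < X w]} ->
  {ae P, forall w, X w <= Y w}.
Proof.
move=> X01 Y01 null.
pose D := [set w | 0 <= Y w] `&` [set w | X w <= 1].
have mD : measurable D.
  apply: measurableI.
    rewrite (_ : [set w | _] = Y @^-1` `[0, +oo[); first exact: measurable_funPTI.
    by apply/seteqP; split => w; rewrite /= in_itv/= andbT.
  rewrite (_ : [set w | _] = X @^-1` `]-oo, 1]); first exact: measurable_funPTI.
  by apply/seteqP; split => w; rewrite /= in_itv/=.
have mm : measurable_fun setT (fun w => Num.max (X w - Y w) 0).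
  by apply: measurable_maxr; [exact: measurable_funB|exact: measurable_cst].
have mYX s : measurable (D `&` [set w | Y w < s < X w]).
  apply: measurableI => //.
  rewrite (_ : [set w | _] = Y @^-1` `]-oo, s[ `&` X @^-1` `]s, +oo[).
    by apply: measurableI; exact: measurable_funPTI.
  apply/seteqP; split => w; rewrite /= !in_itv/= andbT; first by move=> /andP.
  by move=> [-> ->].
have int0 : (\int[P]_(w in D) (1 * Num.max (X w - Y w) 0)%:E = 0)%E.
  rewrite layer_cake//; last 4 first.
  - exact: measurable_funTS.
  - exact: measurable_funTS.
  - by move=> w [].
  - by move=> w [].
  rewrite -[RHS](integral0 mu (`]0%R, 1%R[ : set R)).
  apply: ae_eq_integral => //.
    apply: measurable_funTS; apply: layer_cake_measurable => //; exact: measurable_funTS.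
  apply: ae_imp null => s + s01 => /(_ s01) [N [mN N0 sN]].
  rewrite integral_cst// mul1e; apply/eqP; rewrite eq_le measure_ge0 andbT.
  rewrite [leRHS](_ : _ = P N)//; apply: le_measure; rewrite ?inE//.
  by move=> w [_] /sN.
have int1 : \int[P]_(w in D) (Num.max (X w - Y w) 0) = 0.
  rewrite /Rintegral; suff -> : (\int[P]_(w in D) (Num.max (X w - Y w) 0)%:E = 0)%E by [].
  by rewrite -[RHS]int0; apply: eq_integral => w _; rewrite mul1r.
have im : P.-integrable D (EFin \o (fun w => Num.max (X w - Y w) 0)).
  apply/integrableP; split; first by apply/measurable_EFinP; exact: measurable_funTS.
  apply: (@le_lt_trans _ _ (\int[P]_(w in D) (1 * Num.max (X w - Y w) 0)%:E)%E).
    apply: ge0_le_integral => //.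
    - by apply: measurableT_comp => //; apply/measurable_EFinP; exact: measurable_funTS.
    - by apply/measurable_EFinP/measurable_funTS; apply: measurable_funM.
    - by move=> w _; rewrite /= mul1r ger0_norm// le_max lexx orbT.
  by rewrite int0 ltry.
have := ae_eq0_of_Rintegral mD im _ int1.
have ge0 : {ae P, forall w, D w -> 0 <= Num.max (X w - Y w) 0}.
  by apply: aeW => w _; rewrite le_max lexx orbT.
move=> /(_ ge0) H; apply: filterS3 H X01 Y01 => w /[swap] /andP[X0 X1] /[swap] /andP[Y0 Y1].
move=> /(_ (conj Y0 X1)) /eqP h; rewrite -subr_le0 -(eqP h) le_max lexx//.
Qed.

(** An upper set is a countable union of rays with rational endpoints, up to its
    minimum. *)
Lemma upper_set_negligible (phi : {RV P >-> R}) (B : set R) (E : set T) :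
  upper_set B -> (forall x, B x -> P.-negligible ([set w | x <= phi w] `&` E)) ->
  P.-negligible (phi @^-1` B `&` E).
Proof.
move=> uB nB.
pose G n : set T := if @unpickle rat n is Some r then
  if `[< B (ratr r) >] then [set w | ratr r <= phi w] `&` E else set0 else set0.
have nG : P.-negligible (\bigcup_n G n).
  apply: negligible_bigcup => n; rewrite /G; case: unpickle => [r|]; last exact: negligible_set0.
  by case: asboolP => [/nB//|_]; exact: negligible_set0.
have [[x0 [Bx0 minx0]]|nomin] := pselect (exists x, B x /\ forall y, B y -> x <= y).
  apply: negligibleS (nB _ Bx0) => w [Bw Ew]; split => //=; exact: minx0.
apply: negligibleS nG => w [/= Bw Ew].
have [y By yw] : exists2 y, B y & y < phi w.
  apply: contrapT => no; apply: nomin; exists (phi w); split => // y By.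
  by rewrite leNgt; apply/negP => yw; apply: no; exists y.
have [r] := rat_in_itvoo yw; rewrite in_itv/= => /andP[yr rw].
exists (pickle r); first exact: I.
rewrite /G pickleK.
case: asboolP => [Br|nBr]; first by split => //=; exact: ltW.
by exfalso; apply: nBr; apply: uB By _; exact: ltW.
Qed.

Section increasing_version.
Variables (phi Y : {RV P >-> R}).
Hypothesis phi_gt0 : {ae P, forall w, 0 < phi w}.
Hypothesis phi_mean : ('E_P[phi] = 1)%E.
Hypothesis Y01 : {ae P, forall w, 0 <= Y w <= 1}.
Hypothesis saturated : forall w w', phi w = phi w' -> Y w = Y w'.
Hypothesis np_optimal : {ae mu, forall s, s \in `]0, 1[ ->
  price_gt phi Y s = tail (quantile phi) (dfun Y s)}.

Let S (x : R) : set R := [set s | 0 <= s <= 1 /\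
  P.-negligible ([set w | x <= phi w] `&` [set w | Y w < s])].

(** The essential infimum of [Y] on the event [phi >= x], which is monotone in [x]
    by construction. *)
Definition essinf_above (x : R) : R := sup (S x).
Local Notation h := essinf_above.

Let S0 x : S x 0.
Proof.
split; first by rewrite lexx ler01.
apply: negligibleS Y01 => w [_ /=] Y0; apply/negP; rewrite negb_and -ltNge.
by rewrite Y0.
Qed.

Let S_ub x : ubound (S x) 1. Proof. by move=> s [/andP[]]. Qed.

Let S_sup x : has_sup (S x).
Proof. by split; [exists 0; exact: S0|exists 1; exact: S_ub]. Qed.

Lemma essinf_above_increasing : increasing01 h.
Proof.
split=> [x y _ _ xy|x _].
  apply: le_sup => //; last by exists 0; exact: S0.
  move=> s [s01 ns]; exists s; split => //; split => //.
  by apply: negligibleS ns => w [yw sw]; split => //=; exact: le_trans yw.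
apply/andP; split; first exact: (ub_le_sup (S_sup x).2 (S0 x)).
by apply: sup_le_ub; [exists 0; exact: S0|exact: S_ub].
Qed.

Let X : {RV P >-> R} := RV_of (comp_pos_measurable phi essinf_above_increasing).

Let X01 : {ae P, forall w, 0 <= X w <= 1}.
Proof. by apply: aeW => w; apply: comp_pos_01; exact: essinf_above_increasing. Qed.

Let X_le_Y : {ae P, forall w, X w <= Y w}.
Proof.
apply: ae_le_of_levels => //; apply: aeW => s; rewrite in_itv/= => /andP[s0 s1].
pose B := [set x | P.-negligible ([set w | x <= phi w] `&` [set w | Y w < s])].
have uB : upper_set B.
  move=> x y nx xy; apply: negligibleS nx => w [yw sw]; split => //=.
  exact: le_trans yw.
have nB := upper_set_negligible uB (fun x Bx => Bx).
apply: negligibleS nB => w /= /andP[Ys sX]; split => //.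
have : w \in [set w | s < comp_pos h phi w] by rewrite inE.
rewrite (comp_pos_gt _ _ (ltW s0)) inE => -[_ hs].
have [t [_ nt] st] := sup_gt (ex_intro _ 0 (S0 _)) hs.
apply: negligibleS nt => w' [xw' Ys']; split => //=.
exact: lt_trans st.
Qed.

Let Y_le_X : {ae P, forall w, Y w <= X w}.
Proof.
apply: ae_le_of_levels => //; apply: ae_imp np_optimal => s + s01 => /(_ s01) sE.
have /andP[s0 s1] : 0 < s < 1 by rewrite in_itv/= in s01.
have mgt := measurable_level_gt Y s.
have uE := dfunE_gt Y s.
(* otherwise [s] would be a lower bound of [Y] above the price [phi w] *)
have nX w : 0 < phi w -> X w < s ->
    ~ P.-negligible ([set w' | phi w <= phi w'] `&` [set w' | Y w' < s]).
  move=> p0 Xs nw; suff : s <= X w by rewrite leNgt Xs.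
  rewrite /X /= comp_posE//; apply: (ub_le_sup (S_sup _).2); split => //.
  by rewrite !ltW.
have [u0|u0] := eqVneq (dfun Y s) 0.
  have n0 : P.-negligible [set w | Y w <= s].
    exists (~` [set w | s < Y w]); split; first exact: measurableC.
      rewrite -[LHS]fineK; last by rewrite fin_num_measure//; exact: measurableC.
      by rewrite -uE u0.
    by move=> w /=; rewrite leNgt => /negP.
  apply: negligibleS phi_gt0 => w /= /andP[Xs _] p0; apply: (nX w p0 Xs).
  by apply: negligibleS n0 => w' [_ /= /ltW].
have [u1|u1] := eqVneq (dfun Y s) 1.
  exists [set w | s < Y w]; split => //; last by move=> w /= /andP[].
  have PC : P (~` [set w | s < Y w]) = 1%E.
    rewrite -[LHS]fineK; last by rewrite fin_num_measure//; exact: measurableC.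
    by rewrite -uE u1.
  by rewrite -[X in P X]setCK probability_setC ?PC ?subee//; exact: measurableC.
have u01 : fine (P (~` [set w | s < Y w])) \in `]0, 1[.
  by rewrite -uE in_itv/= !lt_neqAle eq_sym u0 dfun_ge0 u1 dfun_le1.
have eqE : (\int[P]_(w in [set w | (s < Y w)%R]) (pos_part phi w)%:E =
    (tail (quantile phi) (fine (P (~` [set w | (s < Y w)%R]))))%:E)%E.
  by rewrite (price_gtE phi_gt0 phi_mean) sE uE.
have := np_eq phi_gt0 phi_mean mgt u01 eqE; set a := quantile phi _ => good.
have {}good : {ae P, forall w, ((a < phi w -> s < Y w) /\ (phi w < a -> ~ s < Y w)) /\
    0 < phi w} by apply: filterS2 good phi_gt0.
apply: negligibleS (good) => w /= /andP[Xs sY] [[h1 h2] p0].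
have aw : a <= phi w by rewrite leNgt; apply/negP => /h2.
(* on the boundary [phi w' = a = phi w] only saturation decides *)
apply: (nX w p0 Xs); apply: negligibleS (good) => w' [/= ww' Ys'] [[h1' h2'] _].
have : ~ s < Y w' by apply/negP; rewrite -leNgt ltW.
move: (le_trans aw ww'); rewrite le_eqVlt => /predU1P[aw'|/h1'//].
by apply; rewrite -(@saturated w)//; apply/eqP; rewrite eq_le ww' -aw' aw.
Qed.

(** If almost every event [Y > s] is optimal in the Neyman-Pearson lemma, then it
    contains [phi > a] and is contained in [phi >= a] for some threshold [a]; since
    [Y] depends on [phi] only, the boundary [phi = a] is not split either.  Thus
    [Y] is its own essential infimum over the states with higher price density. *)
Lemma increasing_versionP : increasing01 h /\
  {ae P, forall w, Y w = comp_pos h phi w}.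
Proof.
split; first exact: essinf_above_increasing.
apply: filterS2 X_le_Y Y_le_X => w XY YX.
by apply/eqP; rewrite eq_le YX XY.
Qed.

End increasing_version.
End levels.

(** * Optimal profiles on a supporting line *)

Lemma two_step_nested (R : realType) (c : R) (U1 U2 : set R) (x : R) : U1 `<=` U2 ->
  two_step c U1 U2 x = if x \in U1 then 1 else if x \in U2 then c else 0.
Proof.
move=> sub; rewrite /two_step !indicE.
case: (boolP (x \in U1)) => [/set_mem/sub U2x|_].
  by rewrite (mem_set U2x) /=; ring.
by case: (x \in U2) => /=; ring.
Qed.

Section optimal_profiles.
Context {d} {T : measurableType d} {R : realType} {P : probability T R}.
Variables (phi : {RV P >-> R}) (k : R -> R).
Hypothesis phi_gt0 : {ae P, forall w, 0 < phi w}.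
Hypothesis phi_mean : ('E_P[phi] = 1)%E.
Hypothesis wk : weight k.
Local Notation mu := (@lebesgue_measure R).
Local Notation q := (quantile phi).
Let wq : weight q := quantile_weight phi_gt0 phi_mean.

(** Only the law of the claim matters. *)
Lemma rho_neg_ae (Y Y' : {RV P >-> R}) : {ae P, forall w, Y w = Y' w} ->
  rho_neg k Y = rho_neg k Y'.
Proof.
move=> YY'; suff cdfE x : cdf Y x = cdf Y' x.
  apply: eq_integral => t _; congr (k t * _)%:E.
  by rewrite /quantile; congr inf; apply/seteqP; split => x; rewrite /= cdfE.
rewrite /cdf /distribution/= /pushforward.
have E (X : {RV P >-> R}) : P (X @^-1` `]-oo, x]) =
    (\int[P]_(w in X @^-1` `]-oo, x]) 1)%E.
  by rewrite integral_cst ?mul1e//; exact: measurable_funPTI.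
rewrite !E; apply: eq_integral_ae_set => //; try exact: measurable_funPTI.
by apply: filterS YY' => w /=; rewrite /preimage/= => ->.
Qed.

Lemma expectation_ae (X X' : T -> R) : measurable_fun setT X ->
  measurable_fun setT X' -> {ae P, forall w, X w = X' w} ->
  ('E_P[fun w => (phi w * X w)%R] = 'E_P[fun w => (phi w * X' w)%R])%E.
Proof.
move=> mX mX' XX'; rewrite unlock; apply: ae_eq_integral => //.
- by apply/measurable_EFinP; apply: measurable_funM.
- by apply/measurable_EFinP; apply: measurable_funM.
- by apply: filterS XX' => w ->.
Qed.

Lemma V_admissible_NP v f (Y : {RV P >-> R}) : Y = comp_pos f phi :> (T -> R) ->
  V_admissible phi v f -> NP_admissible phi v Y.
Proof.
move=> YE [incf fv]; split; last by rewrite YE fv.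
by apply: aeW => w; rewrite YE; exact: comp_pos_01.
Qed.

Lemma V_solution_of_value v f (c : \bar R) : V_admissible phi v f ->
  V_objective k phi f = c ->
  (forall Y, NP_admissible phi v Y -> c <= rho_neg k Y)%E -> V_solution k phi v f.
Proof.
move=> fv fc cmin; split => // h hv; have [inch _] := hv.
pose Y : {RV P >-> R} := RV_of (comp_pos_measurable phi inch).
rewrite fc (V_objective_rho wk (f := h) (Y := Y))//.
by apply: cmin; exact: V_admissible_NP hv.
Qed.

Lemma ae_distribution (Q : R -> Prop) : {ae distribution P phi, forall x, Q x} ->
  {ae P, forall w, Q (phi w)}.
Proof.
move=> [N [mN N0 sN]]; exists (phi @^-1` N); split => //.
- exact: measurable_funPTI.
- by move=> w /= nQ; apply: sN.
Qed.

Section certificate.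
Variables (v lam m : R).
Hypothesis lam_gt0 : 0 < lam.
Hypothesis mmin : {in `[0, 1], forall u, m <= tail k u - lam * tail q u}.
Local Notation val := (lam * v + m).

(** Weak duality with the multiplier [lam], for a supporting line of slope [lam]. *)
Lemma NP_ge (Y : {RV P >-> R}) : NP_admissible phi v Y ->
  (val%:E <= rho_neg k Y)%E.
Proof.
move=> [Y01]; rewrite expectation_price// lee_fin => vY.
rewrite rho_negE// lee_fin (le_trans _ (lagrangian_le phi_gt0 phi_mean wk lam_gt0 mmin Y))//.
by rewrite lerD2r ler_pM2l.
Qed.

(** Complementary slackness: the capital constraint binds because [lam > 0]. *)
Lemma NP_eq (Y : {RV P >-> R}) : NP_admissible phi v Y ->
  (rho_neg k Y <= val%:E)%E ->
  ('E_P[fun w => (phi w * Y w)%R] = v%:E)%E /\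
  {ae mu, forall s, s \in `]0, 1[ ->
    contact phi k lam m (dfun Y s) /\ price_gt phi Y s = tail q (dfun Y s)}.
Proof.
move=> [Y01]; rewrite expectation_price// lee_fin => vY.
rewrite rho_negE// lee_fin => Yval.
have := lagrangian_le phi_gt0 phi_mean wk lam_gt0 mmin Y => Yge.
have : lam * v <= lam * \int[mu]_(s in `]0, 1[) price_gt phi Y s by rewrite ler_pM2l.
move=> h; have e : lam * v = lam * \int[mu]_(s in `]0, 1[) price_gt phi Y s by lra.
split; first by congr EFin; apply/esym/(mulfI (lt0r_neq0 lam_gt0)).
by apply: (lagrangian_eq phi_gt0 phi_mean wk lam_gt0 mmin); lra.
Qed.

Let value_of_contact (theta : R) (U1 U2 : set R) : 0 <= theta <= 1 ->
  upper_set U1 -> upper_set U2 -> U1 `<=` `]0, +oo[ -> U2 `<=` `]0, +oo[ ->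
  contact phi k lam m (level phi U1) -> contact phi k lam m (level phi U2) ->
  (1 - theta) * tail q (level phi U1) + theta * tail q (level phi U2) = v ->
  V_solution k phi v (two_step theta U1 U2) /\
  V_objective k phi (two_step theta U1 U2) = val%:E.
Proof.
move=> th uU1 uU2 U1p U2p c1 c2 thv.
have V : V_objective k phi (two_step theta U1 U2) = val%:E.
  rewrite V_objective_two_step//; congr EFin; move: c1 c2; rewrite /contact => c1 c2.
  rewrite (_ : tail k (level phi U1) = m + lam * tail q (level phi U1)); last by lra.
  rewrite (_ : tail k (level phi U2) = m + lam * tail q (level phi U2)); last by lra.
  by rewrite -thv; ring.
split=> //; apply: V_solution_of_value V NP_ge; split.
  exact: two_step_increasing.
by rewrite expectation_two_step// thv.
Qed.

(** A contact level whose price is exactly [v] gives an indicator solution. *)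
Lemma one_step_solution (U : set R) :
  upper_set U -> U `<=` `]0, +oo[ -> contact phi k lam m (level phi U) ->
  tail q (level phi U) = v ->
  [/\ classJ phi (two_step 0 U U), V_solution k phi v (two_step 0 U U) &
      V_objective k phi (two_step 0 U U) = val%:E].
Proof.
move=> uU Up cU qU.
have th : 0 <= (0 : R) <= 1 by rewrite lexx ler01.
have qv : (1 - 0) * tail q (level phi U) + 0 * tail q (level phi U) = v by rewrite qU; ring.
have [S V] := value_of_contact th uU uU Up Up cU cU qv.
split => //; split; first by apply: two_step_increasing; rewrite ?lexx ?ler01.
exists (1 / 2), set0, U; split => //.
- by apply/andP; split; lra.
- split => //; move=> x y Ux Uy z /andP[xz zy]; exact: uU xz.
- by rewrite set0I.
- by left.
- by move=> x _; rewrite /two_step indic0/= mulr0 mul0r subr0 mul1r add0r addr0.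
Qed.

(** Two contact levels on both sides of [v] give a solution with one intermediate
    value, chosen to meet the constraint. *)
Lemma two_step_solution (U1 U2 : set R) :
  upper_set U1 -> upper_set U2 -> U1 `<=` `]0, +oo[ -> U2 `<=` `]0, +oo[ ->
  contact phi k lam m (level phi U1) -> contact phi k lam m (level phi U2) ->
  tail q (level phi U1) < v -> v < tail q (level phi U2) ->
  let theta := (v - tail q (level phi U1)) /
               (tail q (level phi U2) - tail q (level phi U1)) in
  [/\ U1 `<=` U2, 0 < theta < 1,
      (1 - theta) * tail q (level phi U1) + theta * tail q (level phi U2) = v,
      (0 < P (phi @^-1` (U2 `\` U1)))%E &
  [/\ classJ phi (two_step theta U1 U2), V_solution k phi v (two_step theta U1 U2) &
      V_objective k phi (two_step theta U1 U2) = val%:E]].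
Proof.
move=> uU1 uU2 U1p U2p c1 c2 q1 q2 theta.
have qq : 0 < tail q (level phi U2) - tail q (level phi U1) by rewrite subr_gt0 (lt_trans q1).
have th : 0 < theta < 1.
  apply/andP; split; first by rewrite divr_gt0// subr_gt0.
  by rewrite /theta ltr_pdivrMr// mul1r; lra.
have thv : (1 - theta) * tail q (level phi U1) + theta * tail q (level phi U2) = v.
  rewrite (_ : _ + _ = tail q (level phi U1) +
    theta * (tail q (level phi U2) - tail q (level phi U1))); last by ring.
  by rewrite /theta mulfVK ?lt0r_neq0//; ring.
have th' : 0 <= theta <= 1 by case/andP: th => /ltW -> /ltW ->.
have I1 := level_itv phi uU1; have I2 := level_itv phi uU2.
have lev : level phi U2 < level phi U1.
  rewrite ltNge; apply/negP => h.
  have : tail q (level phi U2) <= tail q (level phi U1).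
    by move: I1 I2; rewrite !in_itv/= => /andP[? ?] /andP[? ?]; exact: tail_nonincreasing.
  by rewrite leNgt -subr_gt0 qq.
have sub : U1 `<=` U2.
  move=> x U1x; apply: contrapT => nU2x.
  suff : level phi U1 <= level phi U2 by rewrite leNgt lev.
  apply: level_anti => // y U2y; apply: uU1 U1x _; rewrite leNgt; apply/negP => yx.
  by apply: nU2x; apply: uU2 U2y _; exact: ltW.
have Ppos : (0 < P (phi @^-1` (U2 `\` U1)))%E.
  have mU1 := upper_set_measurable uU1; have mU2 := upper_set_measurable uU2.
  have : (P (phi @^-1` ~` U1) <= P (phi @^-1` ~` U2) + P (phi @^-1` (U2 `\` U1)))%E.
    rewrite -measureU.
    - apply: le_measure; rewrite ?inE.
      + exact: (measurable_funPTI phi (measurableC mU1)).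
      + apply: measurableU; first exact: (measurable_funPTI phi (measurableC mU2)).
        exact: (measurable_funPTI phi (measurableD mU2 mU1)).
      + by move=> w /= nU1; have [|] := pselect (U2 (phi w)); [right|left].
    - exact: (measurable_funPTI phi (measurableC mU2)).
    - exact: (measurable_funPTI phi (measurableD mU2 mU1)).
    - by apply/seteqP; split => // w [/= nU2 [/nU2]].
  rewrite !levelE// lt0e measure_ge0 andbT => h; apply/eqP => P0; move: h.
  by rewrite P0 adde0 lee_fin leNgt lev.
split=> //; have [S V] := value_of_contact th' uU1 uU2 U1p U2p c1 c2 thv.
split => //; split; first exact: two_step_increasing.
exists theta, (U2 `\` U1), U1; split => //.
- split => //.
  + move=> x y [U2x nU1x] [U2y nU1y] z /andP[xz zy]; split; first exact: uU2 xz.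
    by move=> U1z; apply: nU1y; exact: uU1 zy.
  + by move=> x y Ux Uy z /andP[xz zy]; exact: uU1 xz.
  + by move=> x [/U2p].
- by apply/seteqP; split => // x [[]].
- by right.
- move=> x _; rewrite /two_step !indicE in_setD.
  have [/set_mem U1x|nU1] := boolP (x \in U1).
    by rewrite (mem_set (sub _ U1x)) /=; ring.
  by rewrite /= andbT; ring.
Qed.

Section uniqueness.
Variable f : R -> R.
Hypothesis Jf : classJ phi f.
Hypothesis f_unique : forall h, classJ phi h -> V_solution k phi v h ->
  {ae distribution P phi, forall x, h x = f x}.
Variable h : R -> R.
Hypothesis h_adm : V_admissible phi v h.
Hypothesis h_val : (V_objective k phi h <= val%:E)%E.

Let incf : increasing01 f. Proof. by case: Jf. Qed.
Let inch : increasing01 h. Proof. by case: h_adm. Qed.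
Let Yf : {RV P >-> R} := RV_of (comp_pos_measurable phi incf).
Let Yh : {RV P >-> R} := RV_of (comp_pos_measurable phi inch).
Let Yf01 : {ae P, forall w, 0 <= Yf w <= 1}.
Proof. by apply: aeW => w; exact: comp_pos_01. Qed.
Let Yh01 : {ae P, forall w, 0 <= Yh w <= 1}.
Proof. by apply: aeW => w; exact: comp_pos_01. Qed.
Let U (s : R) := superlevel h s.
Let L (s : R) := tail q (level phi (U s)).
Let good s := (s \in `]0, 1[) /\ contact phi k lam m (level phi (U s)).

Let uU s : upper_set (U s). Proof. exact: superlevel_upper. Qed.
Let Up s : U s `<=` `]0, +oo[.
Proof. by move=> x [x0 _]; rewrite /= in_itv/= x0. Qed.

Let LE s : s \in `]0, 1[ -> L s = tail q (dfun Yh s).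
Proof.
by rewrite in_itv/= => /andP[/ltW s0 _]; rewrite (dfun_comp_pos (f := h) (phi := phi)).
Qed.

Let U_anti s s' : s <= s' -> U s' `<=` U s.
Proof. by move=> ss' x [x0 s'h]; split => //; exact: le_lt_trans s'h. Qed.

Let L_anti s s' : s <= s' -> L s' <= L s.
Proof.
move=> ss'; have := level_itv phi (@uU s); have := level_itv phi (@uU s').
rewrite !in_itv/= => /andP[a b] /andP[c e]; apply: tail_nonincreasing => //.
by apply: level_anti; [exact: uU|exact: uU|exact: U_anti].
Qed.

Let ae_good : {ae mu, forall s, s \in `]0, 1[ -> good s}.
Proof.
have [||_] := @NP_eq Yh.
- exact: V_admissible_NP h_adm.
- by rewrite -(V_objective_rho (phi := phi) wk (f := h)).
apply: ae_imp => s + s01 => /(_ s01)[c _]; split => //.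
by move: c; rewrite (dfun_comp_pos (f := h) (phi := phi))//; move: s01; rewrite in_itv/= => /andP[/ltW].
Qed.

Let price_h : \int[mu]_(s in `]0, 1[) tail q (dfun Yh s) = v.
Proof.
have [_ hv] := h_adm.
have : ('E_P[fun w => (phi w * Yh w)%R] = v%:E)%E by exact: hv.
rewrite expectation_price// => -[<-].
apply: eq_Rintegral => s; rewrite inE/= => s01; have := s01; rewrite in_itv/= => /andP[/ltW s0 _].
rewrite (dfun_comp_pos (f := h) (phi := phi))// /price_gt.
rewrite (_ : [set w | s < Yh w] = phi @^-1` superlevel h s); last exact: comp_pos_gt.
by rewrite integral_pos_part_upper//; exact: uU.
Qed.

Let f_ae g : classJ phi g -> V_solution k phi v g ->
  {ae P, forall w, g (phi w) = f (phi w)}.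
Proof. by move=> Jg Vg; apply: (ae_distribution (f_unique Jg Vg)). Qed.

(* Two contact levels on both sides of the constraint give an element of the
   class J that solves the problem, so [f] must coincide with all of them. *)
Let f_one s : good s -> L s = v ->
  {ae P, forall w, f (phi w) = \1_(U s) (phi w)}.
Proof.
move=> [s01 cs] Ls; have [J V _] := one_step_solution (@uU s) (@Up s) cs Ls.
apply: filterS (f_ae J V) => w <-.
by rewrite /two_step subr0 mul1r mul0r addr0.
Qed.

Let theta s1 s2 := (v - L s1) / (L s2 - L s1).

Let f_two s1 s2 : good s1 -> good s2 -> L s1 < v -> v < L s2 ->
  [/\ 0 < theta s1 s2 < 1, (0 < P (phi @^-1` (U s2 `\` U s1)))%E,
     U s1 `<=` U s2,
     (1 - theta s1 s2) * L s1 + theta s1 s2 * L s2 = v &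
     {ae P, forall w, f (phi w) = two_step (theta s1 s2) (U s1) (U s2) (phi w)}].
Proof.
move=> [_ c1] [_ c2] l1 l2.
have [sub th thv Ppos [J V _]] :=
  two_step_solution (@uU s1) (@uU s2) (@Up s1) (@Up s2) c1 c2 l1 l2.
split => //; apply: filterS (f_ae J V) => w <- //.
Qed.

Let ae_eq_levels (Y Y' : {RV P >-> R}) :
  {ae P, forall w, 0 <= Y w <= 1} -> {ae P, forall w, 0 <= Y' w <= 1} ->
  {ae mu, forall s, s \in `]0, 1[ ->
    {ae P, forall w, ~ (Y' w < s < Y w) /\ ~ (Y w < s < Y' w)}} ->
  {ae P, forall w, Y w = Y' w}.
Proof.
move=> Y01 Y'01 H.
have H1 : {ae P, forall w, Y w <= Y' w}.
  apply: ae_le_of_levels => //; apply: ae_imp H => s + s01 => /(_ s01).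
  by apply: negligibleS => w /= h1 [].
have H2 : {ae P, forall w, Y' w <= Y w}.
  apply: ae_le_of_levels => //; apply: ae_imp H => s + s01 => /(_ s01).
  by apply: negligibleS => w /= h1 [].
by apply: filterS2 H1 H2 => w h1 h2; apply/eqP; rewrite eq_le h1 h2.
Qed.

Let YfE w : 0 < phi w -> Yf w = f (phi w). Proof. exact: comp_posE. Qed.
Let YhE w : 0 < phi w -> Yh w = h (phi w). Proof. exact: comp_posE. Qed.

Let not_U s x : 0 < x -> h x < s -> ~ U s x.
Proof. by move=> _ hs [_ /(lt_trans hs)]; rewrite ltxx. Qed.

(** If almost every level of [h] meets the constraint exactly, then [f] is the
    indicator of almost every superlevel set of [h]. *)
Let unique_of_tight : {ae mu, forall s, s \in `]0, 1[ -> L s = v} ->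
  {ae P, forall w, Yh w = Yf w}.
Proof.
move=> tight; apply: ae_eq_levels => //.
have G : {ae mu, forall s, s \in `]0, 1[ -> good s /\ L s = v}.
  have [N1 h1] := ae_good; have [N2 h2] := tight.
  by apply: (@filterS2 _ _ (ae_filter_ringOfSetsType mu) _ _ _ _ ae_good tight)
    => s g1 l1 s01; split; [exact: g1|exact: l1].
apply: ae_imp G => s + s01 => /(_ s01)[gs Ls].
apply: filterS2 (f_one gs Ls) phi_gt0 => w fw p0; rewrite YfE// YhE// fw indicE.
have /andP[s0 s1] : 0 < s < 1 by move: s01; rewrite in_itv.
split=> /andP[h1 h2].
  by move: h1; rewrite mem_set ?ltNge ?(ltW s1)//; split.
by move: h2; rewrite memNset ?ltNge ?(ltW s0)//; exact: not_U h1.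
Qed.

Let unique_of_gap s1 s2 : good s1 -> good s2 -> L s1 < v -> v < L s2 ->
  {ae P, forall w, Yh w = Yf w}.
Proof.
move=> g1 g2 l1 l2.
have [/andP[th0 th1] Ppos sub12 thv ftwo] := f_two g1 g2 l1 l2.
set th := theta s1 s2 in th0 th1 thv ftwo.
have Lneq s : good s -> L s <> v.
  move=> gs Ls.
  have : {ae P, forall w, f (phi w) = \1_(U s) (phi w) /\
      f (phi w) = two_step th (U s1) (U s2) (phi w)} by apply: filterS2 (f_one gs Ls) ftwo.
  move=> [N [mN N0 sN]].
  suff : (P (phi @^-1` (U s2 `\` U s1)) <= P N)%E by rewrite N0 leNgt Ppos.
  apply: le_measure; rewrite ?inE//.
    apply: (measurable_funPTI phi); apply: measurableD; exact: upper_set_measurable.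
  move=> w [U2w nU1w]; apply: sN => /= -[-> /esym].
  rewrite two_step_nested// memNset// mem_set// indicE; case: (_ \in _) => /= e.
    by rewrite e ltxx in th1.
  by rewrite e ltxx in th0.
(* hence every superlevel set of [h] is one of the two superlevel sets of [f] *)
have low s : good s -> L s < v ->
    {ae P, forall w, U s (phi w) <-> U s1 (phi w)}.
  move=> gs ls; have [/andP[a0 a1] _ subs _ fs] := f_two gs g2 ls l2.
  apply: filterS2 fs ftwo => w ->; rewrite !two_step_nested//.
  case: (boolP (_ \in U s)) => [/set_mem u|/negP u]; case: (boolP (_ \in U s1)) => [/set_mem u'|/negP u'] //.
  - case: ifP => _ e; first by rewrite -e ltxx in th1.
    by move/eqP: e; rewrite oner_eq0.
  - case: ifP => _ e; first by rewrite e ltxx in a1.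
    by move/eqP: e; rewrite eq_sym oner_eq0.
  - by move=> _; split => /mem_set.
have high s : good s -> v < L s ->
    {ae P, forall w, U s (phi w) <-> U s2 (phi w)}.
  move=> gs ls; have [/andP[a0 a1] _ subs _ fs] := f_two g1 gs l1 ls.
  apply: filterS2 fs ftwo => w ->; rewrite !two_step_nested//.
  case: (boolP (_ \in U s1)) => [/set_mem u _|_]; first by split => _; [exact: sub12|exact: subs].
  case: (boolP (_ \in U s)) => [/set_mem u|/negP u]; case: (boolP (_ \in U s2)) => [/set_mem u'|/negP u'] //.
  - by move=> e; rewrite e ltxx in a0.
  - by move=> e; rewrite -e ltxx in th0.
  - by move=> _; split => /mem_set.
(* [sig] is the level at which [h] changes from one set to the other *)
pose A := [set s | (s \in `]0, 1[) /\ v < L s].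
have A2 : A s2 by case: g2.
have ubA : ubound A 1 by move=> s [+ _]; rewrite in_itv/= => /andP[_ /ltW].
pose sig := sup A.
have s2sig : s2 <= sig by apply: ub_le_sup => //; exists 1.
have sig1 : sig <= 1 by apply: sup_le_ub => //; exists s2.
have sig0 : 0 < sig.
  by apply: lt_le_trans s2sig; case: g2; rewrite in_itv/= => /andP[].
have sig01 : 0 <= sig <= 1 by rewrite (ltW sig0).
have incs : increasing01 (two_step sig (U s1) (U s2)).
  by apply: two_step_increasing => //; exact: uU.
pose Ys : {RV P >-> R} := RV_of (comp_pos_measurable phi incs).
have Ys01 : {ae P, forall w, 0 <= Ys w <= 1} by apply: aeW => w; exact: comp_pos_01.
have hs : {ae P, forall w, Yh w = Ys w}.
  apply: ae_eq_levels => //.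
  have G : {ae mu, forall s, s \in `]0, 1[ -> good s /\ s != sig}.
    have ns : {ae mu, forall s, s != sig}.
      exists [set sig]; split => //; first exact: lebesgue_measure_set1.
      by move=> s /= /negP; rewrite negbK => /eqP.
    by apply: (@filterS2 _ _ (ae_filter_ringOfSetsType mu) _ _ _ _ ae_good ns)
      => s g l s01; split; [exact: g|].
  apply: ae_imp G => s + s01 => /(_ s01)[gs ssig].
  have /andP[s0 s1'] : 0 < s < 1 by move: s01; rewrite in_itv.
  have [lt_s|ge_s] := ltP s sig.
    have Ls : v < L s.
      have [t [_ Lt] st] := sup_gt (ex_intro _ s2 A2) lt_s.
      by apply: (lt_le_trans Lt); apply: L_anti; exact: ltW.
    apply: filterS2 (high _ gs Ls) phi_gt0 => w Uw p0.
    rewrite YhE// /Ys/= comp_posE// two_step_nested//; split=> /andP[h1 h2].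
      have /Uw u2 : U s (phi w) by split.
      move: h1; case: ifP => _; first by rewrite ltNge (ltW s1').
      by rewrite mem_set// ltNge (ltW lt_s).
    have nU : ~ U s2 (phi w) by move=> /Uw; exact: not_U h1.
    move: h2; rewrite memNset; last by move=> /sub12.
    by rewrite memNset// ltNge (ltW s0).
  have {}ge_s : sig < s by rewrite lt_neqAle eq_sym ssig.
  have Ls : L s < v.
    rewrite lt_neqAle; apply/andP; split; first by apply/eqP; exact: Lneq.
    rewrite leNgt; apply/negP => Ls; move: ge_s; rewrite ltNge; apply/negP/negPn.
    by apply: ub_le_sup; [exists 1|split].
  apply: filterS2 (low _ gs Ls) phi_gt0 => w Uw p0.
  rewrite YhE// /Ys/= comp_posE// two_step_nested//; split=> /andP[h1 h2].
    have /Uw u1 : U s (phi w) by split.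
    by move: h1; rewrite mem_set// ltNge (ltW s1').
  have nU : ~ U s1 (phi w) by move=> /Uw; exact: not_U h1.
  move: h2; rewrite memNset//; case: ifP => _; first by rewrite ltNge (ltW ge_s).
  by rewrite ltNge (ltW s0).
(* the two profiles have the same price and different prices at the two
   steps, so the intermediate values agree *)
have sigE : sig = th.
  have [_ hv] := h_adm.
  have := expectation_ae (comp_pos_measurable phi inch) (comp_pos_measurable phi incs) hs.
  rewrite hv (expectation_two_step phi_gt0 phi_mean sig01 (@uU s1) (@uU s2) (@Up s1) (@Up s2)).
  rewrite -/(L s1) -/(L s2) => -[]; rewrite -{1}thv => e.
  have L12 : L s2 - L s1 != 0 by rewrite subr_eq0 gt_eqF// (lt_trans l1).
  by apply/esym/(mulIf L12); move: e; lra.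
apply: filterS3 hs ftwo phi_gt0 => w -> fw p0.
by rewrite YfE// fw /Ys/= comp_posE// sigE.
Qed.

Let L_integrable : mu.-integrable (`]0, 1[ : set R)
  (EFin \o (fun s => tail q (dfun Yh s))).
Proof. exact: tail_dfun_integrable. Qed.

Let tight_of_ge : {ae mu, forall s, s \in `]0, 1[ -> v <= L s} ->
  {ae mu, forall s, s \in `]0, 1[ -> L s = v}.
Proof.
move=> H; have le12 : {ae mu, forall s, (`]0, 1[%classic : set R) s ->
    cst v s <= tail q (dfun Yh s)}.
  by apply: ae_imp H => s + s01 => /(_ s01); rewrite LE.
have := ae_eq_of_Rintegral (m := mu) _ (cst01_integrable v) L_integrable le12.
rewrite price_h Rintegral_cst01 => /(_ (measurable_itv _) erefl).
by apply: ae_imp => s + s01 => /(_ s01); rewrite LE.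
Qed.

Let tight_of_le : {ae mu, forall s, s \in `]0, 1[ -> L s <= v} ->
  {ae mu, forall s, s \in `]0, 1[ -> L s = v}.
Proof.
move=> H; have le12 : {ae mu, forall s, (`]0, 1[%classic : set R) s ->
    tail q (dfun Yh s) <= cst v s}.
  by apply: ae_imp H => s + s01 => /(_ s01); rewrite LE.
have := ae_eq_of_Rintegral (m := mu) _ L_integrable (cst01_integrable v) le12.
rewrite price_h Rintegral_cst01 => /(_ (measurable_itv _) erefl).
by apply: ae_imp => s + s01 => /(_ s01); rewrite LE.
Qed.

(** Almost every superlevel set of an optimal profile is in contact.  If the prices
    of these sets are not almost all equal to [v], then some lie below and some
    above, because their mean is [v]. *)
Lemma unique_solution : {ae P, forall w, comp_pos h phi w = comp_pos f phi w}.
Proof.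
have [[s1 [g1 l1]]|no1] := pselect (exists s, good s /\ L s < v); last first.
  apply: unique_of_tight; apply: tight_of_ge; apply: ae_imp ae_good => s + s01.
  by move=> /(_ s01) gs; rewrite leNgt; apply/negP => ls; apply: no1; exists s.
have [[s2 [g2 l2]]|no2] := pselect (exists s, good s /\ v < L s); last first.
  apply: unique_of_tight; apply: tight_of_le; apply: ae_imp ae_good => s + s01.
  by move=> /(_ s01) gs; rewrite leNgt; apply/negP => ls; apply: no2; exists s.
exact: (unique_of_gap g1 g2).
Qed.

End uniqueness.
End certificate.
End optimal_profiles.

(** * Solving the problem for every capital constraint *)

Section solvability.
Context {d} {T : measurableType d} {R : realType} {P : probability T R}.
Variables (phi : {RV P >-> R}) (k : R -> R).
Hypothesis phi_gt0 : {ae P, forall w, 0 < phi w}.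
Hypothesis phi_mean : ('E_P[phi] = 1)%E.
Hypothesis wk : weight k.
Local Notation mu := (@lebesgue_measure R).
Local Notation q := (quantile phi).
Let wq : weight q := quantile_weight phi_gt0 phi_mean.

(** [Y] is a function of the price density, possibly not a measurable one. *)
Definition price_saturated (Y : T -> R) := forall w w', phi w = phi w' -> Y w = Y w'.

(** What the theorem needs at one value of the constraint: a profile of the class
    J which is optimal even among all claims; every optimal claim that depends on the
    price density only is an increasing profile with binding constraint; uniqueness
    in the class J extends to all solutions. *)
Definition solvable (v : R) : Prop :=
  [/\ exists2 f, classJ phi f & V_admissible phi v f /\
        forall Y, NP_admissible phi v Y -> (V_objective k phi f <= rho_neg k Y)%E,
      forall Y : {RV P >-> R}, NP_minimizer k phi v Y -> price_saturated Y ->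
        ('E_P[fun w => (phi w * Y w)%R] = v%:E)%E /\
        exists2 h, increasing01 h & {ae P, forall w, Y w = comp_pos h phi w} &
      forall f h, classJ phi f ->
        (forall g, classJ phi g -> V_solution k phi v g ->
          {ae distribution P phi, forall x, g x = f x}) ->
        V_solution k phi v h ->
        {ae P, forall w, comp_pos h phi w = comp_pos f phi w}].

Lemma solvable_interior v : 0 < v < 1 -> solvable v.
Proof.
move=> v01.
have qni : {in `[0, 1] &, {homo tail q : u s /~ u <= s}}.
  move=> u s; rewrite !in_itv/= => /andP[u0 u1] /andP[s0 s1] su.
  exact: tail_nonincreasing.
have [lam [m [u1 [u2 [lam0 mmin [i1 c1 l1] [i2 c2 l2]]]]]] :=
  supporting_line (tail_continuous wk) (tail_continuous wq) (tail0 wk) (tail1 k)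
   (fun u => @tail_gt0 _ k wk u) (tail0 wq) (tail1 q) qni v01.
have [[U1 [uU1 U1p cU1 lU1]] _] := contact_upper phi_gt0 phi_mean wk mmin i1 c1.
have [_ [U2 [uU2 U2p cU2 lU2]]] := contact_upper phi_gt0 phi_mean wk mmin i2 c2.
have q1 : tail q (level phi U1) <= v.
  by rewrite (le_trans _ l1)// qni//; exact: level_itv.
have q2 : v <= tail q (level phi U2).
  by rewrite (le_trans l2)// qni//; exact: level_itv.
have [f0 [J0 V0 val0]] : exists f0, [/\ classJ phi f0, V_solution k phi v f0 &
    V_objective k phi f0 = (lam * v + m)%:E].
  have [E1|n1] := eqVneq (tail q (level phi U1)) v.
    have [? ? ?] := one_step_solution phi_gt0 phi_mean wk lam0 mmin uU1 U1p cU1 E1.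
    by exists (two_step 0 U1 U1).
  have [E2|n2] := eqVneq (tail q (level phi U2)) v.
    have [? ? ?] := one_step_solution phi_gt0 phi_mean wk lam0 mmin uU2 U2p cU2 E2.
    by exists (two_step 0 U2 U2).
  have lt1 : tail q (level phi U1) < v by rewrite lt_neqAle n1.
  have lt2 : v < tail q (level phi U2) by rewrite lt_neqAle eq_sym n2.
  have [_ _ _ _ [? ? ?]] :=
    two_step_solution phi_gt0 phi_mean wk lam0 mmin uU1 uU2 U1p U2p cU1 cU2 lt1 lt2.
  by eexists; split; eassumption.
have [inc0 _] := V0.1.
pose Y0 : {RV P >-> R} := RV_of (comp_pos_measurable phi inc0).
have Y0adm : NP_admissible phi v Y0 by exact: V_admissible_NP V0.1.
split.
- exists f0 => //; split; first exact: V0.1.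
  by move=> Y Yadm; rewrite val0; exact: (NP_ge phi_gt0 phi_mean wk lam0 mmin).
- move=> Y [Yadm Ymin] sat.
  have Yval : (rho_neg k Y <= (lam * v + m)%:E)%E.
    rewrite -val0 (V_objective_rho (phi := phi) wk (f := f0) (Y := Y0))//; exact: Ymin.
  have [Yv Yeq] := NP_eq phi_gt0 phi_mean wk lam0 mmin Yadm Yval.
  split => //; have Yopt : {ae mu, forall s, s \in `]0, 1[ ->
      price_gt phi Y s = tail q (dfun Y s)}.
    by apply: ae_imp Yeq => s + s01 => /(_ s01)[].
  have [inch Yh] := increasing_versionP phi_gt0 phi_mean Yadm.1 sat Yopt.
  by eexists; eassumption.
- move=> f h Jf uniq Vh.
  apply: (unique_solution phi_gt0 phi_mean wk lam0 mmin Jf uniq Vh.1).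
  by rewrite -val0; apply: Vh.2; exact: V0.1.
Qed.

(** The case in which only the constant claim [v] is optimal. *)
Lemma solvable_of_constant v f0 : classJ phi f0 -> V_admissible phi v f0 ->
  {ae P, forall w, comp_pos f0 phi w = v} ->
  (forall Y, NP_admissible phi v Y -> (V_objective k phi f0 <= rho_neg k Y)%E) ->
  (forall Y, NP_admissible phi v Y -> (rho_neg k Y <= V_objective k phi f0)%E ->
    {ae P, forall w, Y w = v}) ->
  solvable v.
Proof.
move=> J0 A0 f0v min0 cst0; have [inc0 E0] := A0.
pose Y0 : {RV P >-> R} := RV_of (comp_pos_measurable phi inc0).
have Y0adm : NP_admissible phi v Y0 by exact: V_admissible_NP A0.
have V0 : V_solution k phi v f0 by exact: V_solution_of_value A0 _ min0.
split.
- by exists f0.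
- move=> Y [Yadm Ymin] sat.
  have Yv : {ae P, forall w, Y w = v}.
    apply: cst0 => //; rewrite (V_objective_rho (phi := phi) wk (f := f0) (Y := Y0))//.
    exact: Ymin.
  have YY0 : {ae P, forall w, Y w = comp_pos f0 phi w}.
    by apply: filterS2 Yv f0v => w -> ->.
  split; last by exists f0.
  by rewrite (expectation_ae phi _ (comp_pos_measurable phi inc0) YY0).
- move=> f h Jf uniq Vh; have [inch _] := Vh.1.
  pose Yh : {RV P >-> R} := RV_of (comp_pos_measurable phi inch).
  have hv : {ae P, forall w, Yh w = v}.
    apply: cst0; first exact: V_admissible_NP Vh.1.
    rewrite -(V_objective_rho (phi := phi) wk (f := h) (Y := Yh))//.
    exact: Vh.2.
  have f0f := ae_distribution (uniq _ J0 V0).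
  have fv : {ae P, forall w, comp_pos f phi w = v}.
    by apply: filterS3 f0f f0v phi_gt0 => w ff0 <- p0; rewrite !comp_posE.
  by apply: filterS2 hv fv => w hw ->.
Qed.

Let cst_measurable (c : R) : measurable_fun [set: T] (fun=> c).
Proof. exact: measurable_cst. Qed.

(** A claim of zero risk vanishes, since [tail k] is positive below [1]. *)
Lemma solvable0 : solvable 0.
Proof.
have u0 : upper_set (set0 : set R) by move=> x y.
have th : 0 <= (0 : R) <= 1 by rewrite lexx ler01.
have inc0 := two_step_increasing th u0 u0.
have f0E x : two_step 0 set0 set0 x = 0 :> R by rewrite two_step_nested// !memNset.
have val0 : V_objective k phi (two_step 0 set0 set0) = 0%E.
  rewrite V_objective_two_step//; congr EFin.
  by rewrite level_set0 tail1 !mulr0 addr0.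
apply: (@solvable_of_constant _ (two_step 0 set0 set0)).
- split => //; exists (1 / 2), set0, set0; split => //.
  + by apply/andP; split; lra.
  + by split => // x y.
  + by rewrite set0I.
  + by left.
  + by move=> x _; rewrite f0E !indic0/= mulr0 addr0.
- split => //; rewrite expectation_two_step//; congr EFin.
  by rewrite level_set0 tail1 !mulr0 addr0.
- by apply: filterS phi_gt0 => w p0; rewrite comp_posE.
- move=> Y [Y01 _]; rewrite val0 rho_neg_tail//.
  by apply: integral_ge0 => s _; rewrite lee_fin tail_ge0// dfun_ge0.
move=> Y [Y01 _]; rewrite val0 rho_negE// lee_fin => Y0.
pose Z : {RV P >-> R} := RV_of (cst_measurable 0).
have Z01 : {ae P, forall w, 0 <= Z w <= 1} by apply: aeW => w; rewrite lexx ler01.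
have int0 : \int[mu]_(s in `]0, 1[) tail k (dfun Y s) = 0.
  apply/eqP; rewrite eq_le Y0; apply: Rintegral_ge0 => s _.
  by rewrite tail_ge0// dfun_ge0.
have ge0 : {ae mu, forall s, (`]0, 1[%classic : set R) s -> 0 <= tail k (dfun Y s)}.
  by apply: aeW => s _; rewrite tail_ge0// dfun_ge0.
have := ae_eq0_of_Rintegral (m := mu) _ (tail_dfun_integrable Y wk) ge0 int0.
move=> /(_ (measurable_itv _)) tight.
have YZ : {ae P, forall w, Y w <= Z w}.
  apply: ae_le_of_levels => //; apply: ae_imp tight => s + s01 => /(_ s01) ts.
  have F1 : dfun Y s = 1.
    apply/eqP; rewrite eq_le dfun_le1 leNgt; apply/negP => F1.
    have : 0 < tail k (dfun Y s) by apply: tail_gt0; rewrite // in_itv/= dfun_ge0.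
    by rewrite ts ltxx.
  exists [set w | s < Y w]; split; [exact: measurable_level_gt| |by move=> w /= /andP[]].
  have mgt := measurable_level_gt Y s.
  have PC : P (~` [set w | s < Y w]) = 1%E.
    rewrite -[LHS]fineK; last by rewrite fin_num_measure//; exact: measurableC.
    by rewrite -dfunE_gt F1.
  by rewrite -[X in P X]setCK probability_setC ?PC ?subee//; exact: measurableC.
by apply: filterS2 YZ Y01 => w /= YZ /andP[Y0w _]; apply/eqP; rewrite eq_le Y0w andbT.
Qed.

(** Every event of positive probability has a positive price. *)
Lemma tail_quantile_lt1 u : 0 < u -> u <= 1 -> tail q u < 1.
Proof.
move=> u0 u1; pose t := u / 2.
have t01 : t \in `]0, 1[ by rewrite in_itv/= /t; apply/andP; split; lra.
have := @tail_supergradient _ q wq t u t01; rewrite in_itv/= u1 (ltW u0) => /(_ isT).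
have : tail q t <= 1 by move: t01; rewrite in_itv/= => /andP[? ?]; apply: tail_le1 => //; exact: ltW.
have : 0 < q t * (u - t) by rewrite mulr_gt0 ?(quantile_gt0 phi_gt0)// /t; lra.
rewrite -[t - u]opprB mulrN; lra.
Qed.

(** The whole capital is only paid for by the claim [1], since every event of
    positive probability has a positive price. *)
Lemma solvable1 : solvable 1.
Proof.
have uU : upper_set (`]0, +oo[ : set R) by exact: upper_set_oy.
have th : 0 <= (0 : R) <= 1 by rewrite lexx ler01.
have inc1 := two_step_increasing th uU uU.
have f1E x : 0 < x -> two_step 0 `]0, +oo[ `]0, +oo[ x = 1 :> R.
  by move=> x0; rewrite two_step_nested// mem_set//= in_itv/= x0.
have lev0 : level phi `]0, +oo[ = 0 by rewrite level_oy (dfun_le0 phi_gt0).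
pose f1 : R -> R := two_step 0 `]0, +oo[ `]0, +oo[.
pose Y1 : {RV P >-> R} := RV_of (comp_pos_measurable phi inc1).
have A1 : V_admissible phi 1 f1.
  split => //; rewrite expectation_two_step//; congr EFin.
  by rewrite lev0 (tail0 wq); ring.
have c1 : {ae P, forall w, comp_pos f1 phi w = 1}.
  by apply: filterS phi_gt0 => w p0; rewrite comp_posE// /f1 f1E.
have const Y : NP_admissible phi 1 Y -> {ae P, forall w, Y w = 1}.
  move=> [Y01]; rewrite expectation_price// lee_fin => Y1'.
  have le1 s : price_gt phi Y s <= 1.
    by rewrite (le_trans (price_gt_le phi_gt0 phi_mean Y s))// (tail_le1 wq)// ?dfun_ge0 ?dfun_le1.
  have le12 : {ae mu, forall s, (`]0, 1[%classic : set R) s ->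
      price_gt phi Y s <= cst 1 s} by apply: aeW.
  have int12 : \int[mu]_(s in `]0, 1[) price_gt phi Y s = \int[mu]_(s in `]0, 1[) cst 1 s.
    apply/eqP; rewrite eq_le Rintegral_cst01 Y1' andbT.
    rewrite -[leRHS]Rintegral_cst01; apply: le_Rintegral => //.
      exact: price_gt_integrable.
    exact: cst01_integrable.
  have := ae_eq_of_Rintegral (m := mu) _
    (price_gt_integrable phi_gt0 phi_mean Y) (cst01_integrable 1) le12 int12.
  move=> /(_ (measurable_itv _)) tight.
  pose Z : {RV P >-> R} := RV_of (cst_measurable 1).
  have Z01 : {ae P, forall w, 0 <= Z w <= 1} by apply: aeW => w; rewrite ler01 lexx.
  have ZY : {ae P, forall w, Z w <= Y w}.
    apply: ae_le_of_levels => //; apply: ae_imp tight => s + s01 => /(_ s01) ts.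
    have F0 : dfun Y s = 0.
      apply/eqP; rewrite eq_le dfun_ge0 andbT leNgt; apply/negP => F0.
      have := tail_quantile_lt1 F0 (dfun_le1 Y s).
      have := price_gt_le phi_gt0 phi_mean Y s.
      by rewrite ts /=; lra.
    have mgt := measurable_level_gt Y s.
    exists (~` [set w | s < Y w]); split; first exact: measurableC.
      rewrite -[LHS]fineK; last by rewrite fin_num_measure//; exact: measurableC.
      by rewrite -dfunE_gt F0.
    by move=> w /= /andP[Ys _]; apply/negP; rewrite -leNgt ltW.
  by apply: filterS2 ZY Y01 => w /= ZY /andP[_ Yw]; apply/eqP; rewrite eq_le Yw.
apply: (@solvable_of_constant _ f1) => //.
- split => //; exists (1 / 2), set0, `]0, +oo[%classic; split => //.
  + by apply/andP; split; lra.
  + split => //; exact: interval_is_interval.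
  + by rewrite set0I.
  + by left.
  + move=> x; rewrite in_itv/= andbT => x0; rewrite /f1 f1E// indic0/= mulr0 add0r.
    by rewrite indicE mem_set//= in_itv/= x0.
- move=> Y Yadm; rewrite (V_objective_rho (phi := phi) wk (f := f1) (Y := Y1))//.
  rewrite (@rho_neg_ae _ _ _ _ k Y1 Y)//.
  by apply: filterS2 (const Y Yadm) c1 => w ->.
- by move=> Y Yadm _; exact: const.
Qed.

Lemma solvableP v : 0 <= v <= 1 -> solvable v.
Proof.
move=> /andP[]; rewrite le_eqVlt => /predU1P[<- _|v0]; first exact: solvable0.
rewrite le_eqVlt => /predU1P[->|v1]; first exact: solvable1.
by apply: solvable_interior; rewrite v0.
Qed.

Lemma sigma_measurable_comp f : increasing01 f ->
  sigma_measurable phi (comp_pos f phi).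
Proof.
move=> incf _ B mB; rewrite setTI.
exists ((f \_ (`]0, +oo[ : set R)) @^-1` B); last by rewrite setTI.
by rewrite -[X in measurable X]setTI; exact: (restrict_measurable incf).
Qed.

(** A set of the form [phi^-1(B)] does not separate states of equal price. *)
Lemma sigma_measurable_saturated (X : T -> R) :
  sigma_measurable phi X -> price_saturated X.
Proof.
move=> mX w w' ww'; have := mX measurableT [set X w] (measurable_set1 _).
rewrite setTI => -[B mB]; rewrite setTI => BE.
have : (phi @^-1` B) w by rewrite BE.
by rewrite /preimage/= ww' => h; have : (phi @^-1` B) w' by []; rewrite BE => /= ->.
Qed.

End solvability.

Theorem theorem4p1 (d : measure_display) (T : measurableType d) (R : realType)
    (P : probability T R) (P_atomless : atomless P)
    (phi : {RV P >-> R}) (phi_gt0 : {ae P, forall w, 0 < phi w})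
    (phi_mean : ('E_P[phi] = 1)%E)
    (k : R -> R) (k_weight : density_weight k)
    (v : R) (v01 : 0 <= v <= 1) :
  [/\ (* (a) *)
      forall f : R -> R, V_solution k phi v f ->
        NP_solution k phi v (comp_pos f phi),
      (* (b) *)
      exists2 f : R -> R, classJ phi f & V_solution k phi v f,
      (* (c): [f] solves (V) after a modification on a null set, and [f]
         itself solves (V) if it belongs to the class over which (V) is posed *)
      forall f : R -> R, NP_solution k phi v (comp_pos f phi) ->
        (exists2 h : R -> R, V_solution k phi v h &
          {ae P, forall w, comp_pos f phi w = comp_pos h phi w}) /\
        (increasing01 f -> V_solution k phi v f) &
      (* (d) *)
      forall f : R -> R, classJ phi f -> V_solution k phi v f ->
        (forall h : R -> R, classJ phi h -> V_solution k phi v h ->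
          {ae distribution P phi, forall x, h x = f x}) ->
        [/\ NP_solution k phi v (comp_pos f phi),
            sigma_measurable phi (comp_pos f phi) &
            forall X : T -> R, sigma_measurable phi X ->
              NP_solution k phi v X ->
              {ae P, forall w, X w = comp_pos f phi w}]].
Proof.
have wk := weight_density k_weight.
have [[f0 J0 [A0 min0]] H2 H3] := solvableP phi_gt0 phi_mean wk v01.
have [inc0 _] := A0.
pose Y0 : {RV P >-> R} := RV_of (comp_pos_measurable phi inc0).
have V0 : V_solution k phi v f0 by exact: V_solution_of_value A0 _ min0.
have a f : V_solution k phi v f -> NP_solution k phi v (comp_pos f phi).
  move=> [[incf fv] fmin]; exists (RV_of (comp_pos_measurable phi incf)) => //.
  split; first exact: (@V_admissible_NP _ _ _ _ phi v f).
  move=> Y Yadm; rewrite -(V_objective_rho (phi := phi) wk (f := f))//.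
  by apply: (le_trans (fmin _ A0)); exact: min0.
have c1 X : NP_solution k phi v X -> price_saturated phi X ->
    exists2 h, V_solution k phi v h & {ae P, forall w, X w = comp_pos h phi w}.
  move=> [X' X'E X'min] sat; rewrite -X'E in sat *.
  have [X'v [h inch Xh]] := H2 _ X'min sat.
  have mh := comp_pos_measurable phi inch.
  exists h => //; split; first by split; rewrite // -(expectation_ae phi _ mh Xh).
  move=> g Vg; have [incg _] := Vg.
  pose Yg : {RV P >-> R} := RV_of (comp_pos_measurable phi incg).
  rewrite (V_objective_rho (phi := phi) wk (f := h) (Y := RV_of mh))//.
  rewrite (V_objective_rho (phi := phi) wk (f := g) (Y := Yg))//.
  rewrite -(@rho_neg_ae _ _ _ _ k X' (RV_of mh))//.
  by apply: X'min.2; exact: V_admissible_NP Vg.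
have sat_comp f : price_saturated phi (comp_pos f phi).
  by move=> w w'; rewrite /comp_pos/= => ->.
split => //.
- by exists f0.
- move=> f Nf; split; first exact: c1.
  move=> incf; have [X XE Xmin] := Nf.
  have [Xv _] : ('E_P[fun w => (phi w * X w)%R] = v%:E)%E /\ True.
    by split => //; have [] := H2 _ Xmin; rewrite ?XE.
  split; first by split; rewrite // -XE.
  move=> g Vg; have [incg _] := Vg.
  pose Yg : {RV P >-> R} := RV_of (comp_pos_measurable phi incg).
  rewrite (V_objective_rho (phi := phi) wk (f := f) (Y := X))//.
  rewrite (V_objective_rho (phi := phi) wk (f := g) (Y := Yg))//.
  by apply: Xmin.2; exact: V_admissible_NP Vg.
- move=> f Jf Vf uniq; have [incf _] := Vf.1; split; first exact: a.
    exact: sigma_measurable_comp.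
  move=> X sX NX.
  have [h Vh Xh] := c1 _ NX (sigma_measurable_saturated sX).
  by apply: filterS2 Xh (H3 _ _ Jf uniq Vh) => w -> ->.
Qed.
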